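(* Let $f_0(t)$ denote the height at site $0$ and time $t$ of the RSOS surface on $\mathbb{Z}$ (dimension $d=1$) started from the zero initial condition and driven by independent rate-$1$ Poisson clocks. Then $$\liminf_{t\to\infty}\frac{\operatorname{Var}(f_0(t))}{\log t}>0 .$$
   Context: RSOS (Restricted Solid-on-Solid) model on $\mathbb{Z}$: independent rate-$1$ Poisson clocks are attached to the sites of $\mathbb{Z}$. The height $f:\mathbb{R}_+\times\mathbb{Z}\to\mathbb{Z}$ is right-continuous in time; the height at $x$ can only change when the clock at $x$ rings, and when the clock at $x$ rings at time $t$, $$f(t,x)=f(t^-,x)+\mathbf{1}\{f(t^-,x)\le f(t^-,x+1)\}\,\mathbf{1}\{f(t^-,x)\le f(t^-,x-1)\},$$ where $t^-$ denotes the left limit in time. The process is almost surely well defined. Zero initial condition means $f(0,x)=0$ for all $x\in\mathbb{Z}$, and $f_0(t)=f(t,0)$. *)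

(* Defs.v *)
From HB Require Import structures.
From mathcomp Require Import all_boot all_order all_algebra finmap.
From mathcomp Require Import all_classical all_reals all_analysis.

Set Implicit Arguments.
Unset Strict Implicit.
Unset Printing Implicit Defensive.

Import Order.TTheory GRing.Theory Num.Theory.
Import numFieldNormedType.Exports.

Local Open Scope classical_set_scope.
Local Open Scope ring_scope.

HB.instance Definition _ := isPointed.Build int 0.
HB.instance Definition _ := @isMeasurable.Build default_measure_display
  int discrete_measurable discrete_measurable0
  discrete_measurableC discrete_measurableU.

Definition mutually_independent (R : realType) (d : measure_display)
    (T : measurableType d) (P : probability T R) (I : choiceType)
    (G : I -> set_system T) : Prop :=
  forall (J : {fset I}) (E : I -> set T),
    (forall i, i \in J -> G i (E i)) ->
    P (\bigcap_(i in [set` J]) E i) = (\prod_(i <- J) P (E i))%E.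

Definition sigma_of_variable (d d' : measure_display) (T : measurableType d)
    (T' : measurableType d') (X : T -> T') : set_system T :=
  preimage_set_system setT X measurable.

(* Processes are indexed by all of R; only the times t >= 0 are meaningful. *)
Definition sigma_of_process (R : realType) (d d' : measure_display)
    (T : measurableType d) (T' : measurableType d') (X : R -> T -> T') :
    set_system T :=
  <<s \bigcup_(t in [set t : R | 0 <= t]) sigma_of_variable (X t) >>.

Definition counting_path (R : realType) (n : R -> nat) : Prop :=
  [/\ n 0 = 0%N,
      forall s t, 0 <= s -> s <= t -> (n s <= n t)%N &
      forall t, 0 <= t -> \forall s \near t^'+, n s = n t].

(* The truncated subtraction on nat is harmless: paths are a.s. nondecreasing.
   Increments are only taken over s < t in the third clause because
   [poisson_pmf 0] is not the Dirac mass at 0. *)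
Definition poisson_process (R : realType) (d : measure_display)
    (T : measurableType d) (P : probability T R) (rate : R)
    (N : R -> {RV P >-> nat}) : Prop :=
  [/\ \forall w \ae P, counting_path (fun t => N t w),
      forall t : nat -> R, 0 <= t 0%N -> (forall i, t i <= t i.+1) ->
        mutually_independent P (fun i : nat =>
          sigma_of_variable (fun w => (N (t i.+1) w - N (t i) w)%N)) &
      forall (s t : R) (k : nat), 0 <= s -> s < t ->
        P [set w | (N t w - N s w)%N = k] = (poisson_pmf (rate * (t - s)) k)%:E].

Definition independent_poisson_clocks (R : realType) (d : measure_display)
    (T : measurableType d) (P : probability T R)
    (N : int -> R -> {RV P >-> nat}) : Prop :=
  (forall x, poisson_process 1 (N x)) /\
  mutually_independent P (fun x : int => sigma_of_process (N x)).

(* Left limits of discrete-valued paths: the path is eventually constant. *)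
Definition has_left_limit (R : realType) (A : Type) (g : R -> A) (t : R)
    (a : A) : Prop :=
  \forall s \near t^'-, g s = a.

(* The clock with counting path n rings at its jump times. *)
Definition rings (R : realType) (n : R -> nat) (t : R) : Prop :=
  ~ has_left_limit n t (n t).

Definition rsos_update (h : int -> int) (x : int) : int :=
  h x + (h x <= h (x + 1))%R%:R * (h x <= h (x - 1))%R%:R.

(* In the last clause h is the height profile f(t^-, .). *)
Definition rsos_dynamics (R : realType) (n : int -> R -> nat)
    (f : R -> int -> int) : Prop :=
  (forall t x, 0 <= t -> \forall s \near t^'+, f s x = f t x) /\
  (forall t, 0 < t -> exists h : int -> int,
    (forall x, has_left_limit (fun s => f s x) t (h x)) /\
    (forall x, (rings (n x) t -> f t x = rsos_update h x) /\
               (~ rings (n x) t -> f t x = h x))).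

Definition rsos_from_zero (R : realType) (d : measure_display)
    (T : measurableType d) (P : probability T R)
    (N : int -> R -> {RV P >-> nat}) (f : R -> int -> {RV P >-> int}) : Prop :=
  \forall w \ae P,
    rsos_dynamics (fun x t => N x t w) (fun t x => f t x w) /\
    (forall x, f 0 x w = 0).

(* Main.v *)
Require Import Defs.
From mathcomp Require Import all_boot all_order all_algebra finmap.
From mathcomp Require Import all_classical all_reals all_analysis.
From mathcomp Require Import measurable_realfun.
From mathcomp Require Import ring lra zify.

(** Why the variance of f(t,0) is at least of order log t.

Let X be the height at the origin at time t and v its rate of growth. The
height only increases when a clock rings, and speeding up all clocks during a
short time interval ending s before t has the same effect on the law of X as
prolonging the evolution: the expected response of X, summed over all sites, is
v, whatever s is. By finite propagation almost all of this response comes from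
the sites within distance r + C s of the origin. Let g be the centred number of
rings, each ring being weighted by 1 / (r + C s) inside this cone and by 0
outside. Its variance and its covariance with X are both sums over the cone:
Var g is of order H and Cov(X, g) of order v H, where H, the integral of
1 / (r + C s) over the time interval, is of order log t. The Cauchy-Schwarz
inequality gives Var X >= v^2 H up to a constant ([linear_response]).

It remains to see that v is bounded below at some time close to t. If the
variance V of X at time t is small, then the surface at time t is nearly flat: by
Chebyshev's inequality at finitely many points, and since neighbouring heights
differ by at most 1, it lies within a multiple of lam = sqrt V + 1 of its mean on
an interval of length a large multiple of lam. A flat surface grows linearly, so
during an additional time of order lam the mean height at the origin grows by a
positive multiple of lam ([growth]). Hence at some intermediate time t' the
growth rate is at least 1/26, and H is at most a multiple of Var f(t',0). As t' - t
is of order lam, Var f(t',0) is at most a multiple of V + 1; thus V + 1 is at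
least a multiple of log t ([discrete_variance]).

Linear growth from the flat surface comes from translation invariance: a site
which is not a local minimum has a neighbour which is lower by at least 1, so that
local minima carry at least half of E exp(- 2 f), and this quantity decays
exponentially ([expect_expR_flat]).

All this is done for a chain with finitely many random inputs. The half line of
times is cut into slots, space is made periodic, and each slot contains either
no ring or a single ring at a uniform site ([step], [run]). With positive
probability, as close to 1 as desired when the slots are short, every slot of
[0, t] contains at most one ring in the window [-L, L]; given this event the
contents of the slots are independent, and the height at the origin is the one of
the chain unless information has travelled from the boundary of the window to the
origin ([matches_run], [probability_slot_event]). Integrating the squared
deviation of X over this event bounds the variance of X below by that of the
chain ([integral_height_ge]), the contribution of contaminated configurations
being negligible for large L ([expect_far_le]). *)

Set Implicit Arguments.
Unset Strict Implicit.
Unset Printing Implicit Defensive.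

Import Order.TTheory GRing.Theory Num.Theory.
Import numFieldNormedType.Exports.

Local Open Scope classical_set_scope.
Local Open Scope ring_scope.

(** * Expectation over independent slots *)

Section FiniteExpectation.
Variables (R : realType) (O : finType) (w : O -> R).

Definition expect1 (G : O -> R) : R := \sum_o w o * G o.

(** Law of [k] independent slots, generated from the first to the last; the
recursion makes conditioning on the first slots a matter of computation
([expect_cat]). *)
Fixpoint expect (k : nat) (G : seq O -> R) : R :=
  if k is k'.+1 then expect1 (fun o => expect k' (fun s => G (o :: s))) else G [::].

Lemma eq_expect1 (G H : O -> R) : G =1 H -> expect1 G = expect1 H.
Proof. by move=> GH; apply: eq_bigr => o _; rewrite GH. Qed.

Lemma eq_expect k (G H : seq O -> R) :
  (forall s, size s = k -> G s = H s) -> expect k G = expect k H.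
Proof.
elim: k G H => [|k IH] G H GH /=; first exact: GH.
by apply: eq_expect1 => o; apply: IH => s sk; apply: GH; rewrite /= sk.
Qed.

Lemma expect1D (G H : O -> R) : expect1 (fun o => G o + H o) = expect1 G + expect1 H.
Proof. by rewrite /expect1 -big_split; apply: eq_bigr => o _ /=; rewrite mulrDr. Qed.

Lemma expect1Z c (G : O -> R) : expect1 (fun o => c * G o) = c * expect1 G.
Proof. by rewrite /expect1 mulr_sumr; apply: eq_bigr => o _; rewrite mulrCA. Qed.

Lemma expectD k (G H : seq O -> R) : expect k (fun s => G s + H s) = expect k G + expect k H.
Proof.
elim: k G H => [|k IH] G H //=.
by rewrite -expect1D; apply: eq_expect1 => o; rewrite IH.
Qed.

Lemma expectZ k c (G : seq O -> R) : expect k (fun s => c * G s) = c * expect k G.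
Proof.
elim: k G => [|k IH] G //=.
by rewrite -expect1Z; apply: eq_expect1 => o; rewrite IH.
Qed.

Lemma expectZr k c (G : seq O -> R) : expect k (fun s => G s * c) = expect k G * c.
Proof. by rewrite mulrC -expectZ; apply: eq_expect => s _; rewrite mulrC. Qed.

Lemma expectN k (G : seq O -> R) : expect k (fun s => - G s) = - expect k G.
Proof. by rewrite -mulN1r -expectZ; apply: eq_expect => s _; rewrite mulN1r. Qed.

Lemma expectB k (G H : seq O -> R) : expect k (fun s => G s - H s) = expect k G - expect k H.
Proof. by rewrite expectD expectN. Qed.

Lemma expect0 k : expect k (fun=> 0) = 0.
Proof.
transitivity (expect k (fun=> 0 * 0)); first by apply: eq_expect => s _; rewrite mul0r.
by rewrite (expectZ k 0 (fun=> 0)) mul0r.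
Qed.

Lemma expect_sum k (I : Type) (r : seq I) (Q : pred I) (G : I -> seq O -> R) :
  expect k (fun s => \sum_(i <- r | Q i) G i s) = \sum_(i <- r | Q i) expect k (G i).
Proof.
elim: r => [|i r IH].
  by rewrite big_nil -[RHS](expect0 k); apply: eq_expect => s _; rewrite big_nil.
rewrite big_cons; case: ifP => Qi.
  rewrite -IH -expectD; apply: eq_expect => s _.
  by rewrite big_cons Qi.
by rewrite -IH; apply: eq_expect => s _; rewrite big_cons Qi.
Qed.

Lemma expect_expect1 k (G : O -> seq O -> R) :
  expect k (fun s => expect1 (G ^~ s)) = expect1 (fun o => expect k (G o)).
Proof.
rewrite /expect1 expect_sum; apply: eq_bigr => o _.
by rewrite -expectZ.
Qed.

Lemma expect_cat i j (G : seq O -> R) :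
  expect (i + j) G = expect i (fun s => expect j (fun s' => G (s ++ s'))).
Proof.
by elim: i G => [|i IH] G //=; apply: eq_expect1 => o; rewrite IH.
Qed.

Lemma expect_rcons k (G : seq O -> R) :
  expect k.+1 G = expect k (fun s => expect1 (fun o => G (rcons s o))).
Proof.
rewrite -addn1 expect_cat; apply: eq_expect => s _ /=.
by apply: eq_expect1 => o; rewrite cats1.
Qed.

Hypothesis w_ge0 : forall o, 0 <= w o.
Hypothesis w_sum : \sum_o w o = 1.

Lemma expect1_cst c : expect1 (fun=> c) = c.
Proof. by rewrite /expect1 -mulr_suml w_sum mul1r. Qed.

Lemma expect_cst k c : expect k (fun=> c) = c.
Proof. by elim: k => [|k IH] //=; rewrite IH expect1_cst. Qed.

Lemma le_expect1 (G H : O -> R) : (forall o, G o <= H o) -> expect1 G <= expect1 H.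
Proof. by move=> GH; apply: ler_sum => o _; rewrite ler_wpM2l. Qed.

Lemma le_expect k (G H : seq O -> R) :
  (forall s, size s = k -> G s <= H s) -> expect k G <= expect k H.
Proof.
elim: k G H => [|k IH] G H GH /=; first exact: GH.
by apply: le_expect1 => o; apply: IH => s sk; apply: GH; rewrite /= sk.
Qed.

Lemma expect_ge0 k (G : seq O -> R) : (forall s, size s = k -> 0 <= G s) -> 0 <= expect k G.
Proof. by move=> G0; rewrite -(expect0 k); apply: le_expect. Qed.

(** The usual discriminant argument; when the second factor of the bound vanishes
the quadratic form is affine in its second parameter, which forces the mixed
expectation to vanish. *)
Lemma expect_CauchySchwarz k (F G : seq O -> R) :
  (expect k (fun s => F s * G s)) ^+ 2 <=
  expect k (fun s => F s ^+ 2) * expect k (fun s => G s ^+ 2).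
Proof.
set A := expect k (fun s => F s ^+ 2); set B := expect k _.
set C := expect k (fun s => G s ^+ 2).
(* the expectation of a square, expanded *)
have quad a b : 0 <= a ^+ 2 * A - 2 * a * b * B + b ^+ 2 * C.
  have <- : expect k (fun s => (a * F s - b * G s) ^+ 2) =
            a ^+ 2 * A - 2 * a * b * B + b ^+ 2 * C.
    rewrite -!expectZ -expectB -expectD; apply: eq_expect => s _; ring.
  by apply: expect_ge0 => s _; exact: sqr_ge0.
have C0 : 0 <= C by apply: expect_ge0 => s _; exact: sqr_ge0.
have [C_gt0|C_le0] := ltP 0 C.
  by have := quad C B; nra.
have CE : C = 0 by apply/eqP; rewrite eq_le C_le0.
have [->|B0] := eqVneq B 0; first by rewrite CE expr0n mulr0.
have := quad 1 ((A + 1) / B).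
rewrite CE mulr0 addr0 expr1n mul1r mulr1.
rewrite -mulrA divfK // => h.
have A0 : 0 <= A by apply: expect_ge0 => s _; exact: sqr_ge0.
lra.
Qed.

End FiniteExpectation.

(** * Dynamics driven by a sequence of slots *)

Definition local_min (h : int -> int) (x : int) : bool :=
  (h x <= h (x + 1)) && (h x <= h (x - 1)).

Lemma rsos_updateE (h : int -> int) x : rsos_update h x = h x + (local_min h x)%:Z.
Proof.
by rewrite /rsos_update /local_min; case: (h x <= _); case: (h x <= _).
Qed.

Section Dynamics.
Variable L : nat.

Definition period : nat := L.*2.+1.

(** [None] is a slot without ring, [Some x] a slot whose only ring is at the sites
congruent to [x - L] modulo the period: the residues are represented by the
window [-L, L]. *)
Definition slot : Type := option 'I_period.

Definition hits (o : slot) (y : int) : bool :=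
  if o is Some x then ((y + L%:Z) %% period%:Z)%Z == x%:Z else false.

Definition step (h : int -> int) (o : slot) : int -> int :=
  fun y => if hits o y then rsos_update h y else h y.

Definition run (h : int -> int) (s : seq slot) : int -> int := foldl step h s.

(** Sites whose height may depend on what happens in the initial set [B]: a ringing
site becomes contaminated when one of its two neighbours is. *)
Definition stepB (B : int -> bool) (o : slot) : int -> bool :=
  fun y => B y || hits o y && (B (y + 1) || B (y - 1)).

Definition runB (B : int -> bool) (s : seq slot) : int -> bool := foldl stepB B s.

Definition flat : int -> int := fun=> 0.

Lemma period_gt0 : (0 < period)%N. Proof. by []. Qed.

Lemma step_ge h o y : h y <= step h o y.
Proof. by rewrite /step; case: ifP => // _; rewrite rsos_updateE; lia. Qed.

Lemma step_le h o y : step h o y <= h y + (hits o y)%:Z.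
Proof. by rewrite /step; case: ifP => // _; rewrite ?rsos_updateE; lia. Qed.

(** Monotonicity survives the tie where [h] and [g] agree at a ringing site: if [h]
can grow there then so can [g], whose neighbours are higher. *)
Lemma step_mono h g o : (forall y, h y <= g y) -> forall y, step h o y <= step g o y.
Proof.
move=> hg y; rewrite /step; case: ifP => // _; rewrite !rsos_updateE /local_min.
have := hg y; have := hg (y + 1); have := hg (y - 1); lia.
Qed.

Lemma step_shift h c o y : step (fun z => h z + c) o y = step h o y + c.
Proof.
rewrite /step; case: ifP => // _; rewrite !rsos_updateE /local_min !lerD2r; lia.
Qed.

Lemma step_local h g (B : int -> bool) o : (forall y, ~~ B y -> h y = g y) ->
  forall y, ~~ stepB B o y -> step h o y = step g o y.
Proof.
move=> hg y; rewrite /stepB /step negb_or => /andP[By].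
case: (hits o y) => /=; last by move=> _; exact: hg.
rewrite negb_or => /andP[B1 B2].
by rewrite !rsos_updateE /local_min !hg.
Qed.

Definition lipschitz1 (h : int -> int) :=
  forall y, (h y <= h (y + 1) + 1) && (h y <= h (y - 1) + 1).

(** A site only grows when it is not above its neighbours, so it ends at most one
unit above them. *)
Lemma step_lipschitz h o : lipschitz1 h -> lipschitz1 (step h o).
Proof.
move=> hl y; have := hl y.
have := step_ge h o (y + 1); have := step_ge h o (y - 1).
rewrite /step; case: (hits o y); last by lia.
by rewrite !rsos_updateE /local_min; lia.
Qed.

Lemma eq_run h g s : h =1 g -> run h s =1 run g s.
Proof. by move=> /funext ->. Qed.

Lemma run_rcons h s o : run h (rcons s o) = step (run h s) o.
Proof. by rewrite /run -cats1 foldl_cat. Qed.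

Lemma runB_rcons h s o : runB h (rcons s o) = stepB (runB h s) o.
Proof. by rewrite /runB -cats1 foldl_cat. Qed.

Lemma run_cat h s s' : run h (s ++ s') = run (run h s) s'.
Proof. by rewrite /run foldl_cat. Qed.

Lemma run_ge h s y : h y <= run h s y.
Proof.
elim: s h => //= o s IH h; exact: le_trans (step_ge h o y) (IH _).
Qed.

Lemma run_mono h g s : (forall y, h y <= g y) -> forall y, run h s y <= run g s y.
Proof. by elim: s h g => //= o s IH h g hg y; apply: IH => z; exact: step_mono. Qed.

Lemma run_shift h c s y : run (fun z => h z + c) s y = run h s y + c.
Proof.
elim: s h => //= o s IH h; rewrite -IH; apply: eq_run => z; exact: step_shift.
Qed.

Lemma run_local h g (B : int -> bool) s : (forall y, ~~ B y -> h y = g y) ->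
  forall y, ~~ runB B s y -> run h s y = run g s y.
Proof.
elim: s h g B => //= o s IH h g B hg y; apply: IH => z; exact: step_local.
Qed.

Lemma run_lipschitz h s : lipschitz1 h -> lipschitz1 (run h s).
Proof. by elim: s h => //= o s IH h hl; apply: IH; exact: step_lipschitz. Qed.

Lemma flat_lipschitz : lipschitz1 flat. Proof. by []. Qed.

Lemma lipschitz_dist h y z : lipschitz1 h -> `|h y - h z| <= `|y - z|.
Proof.
move=> hl.
have up (k : nat) u : `|h (u + k%:Z) - h u| <= k%:Z.
  elim: k => [|k IH]; first by rewrite addr0 subrr.
  have := hl (u + k%:Z); have := hl (u + k%:Z + 1).
  have -> : u + k.+1%:Z = u + k%:Z + 1 by lia.
  rewrite addrK; lia.
case: (leP z y) => zy.
  by have := up `|y - z|%N z; rewrite (_ : z + _ = y); lia.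
by have := up `|z - y|%N y; rewrite (_ : y + _ = z); lia.
Qed.

Definition hitcount (s : seq slot) (y : int) : nat := count (fun o => hits o y) s.

Lemma run_le h s y : run h s y <= h y + (hitcount s y)%:Z.
Proof.
elim: s h => [|o s IH] h /=; first by rewrite addr0.
have := IH (step h o); have := step_le h o y; rewrite /hitcount /=; lia.
Qed.

(** An additional ring raises the surface by at most one unit, hence, by
monotonicity and invariance under vertical shifts, it never contributes more than
one unit later, and nothing at all at uncontaminated sites. *)
Lemma run_extra h s (B : int -> bool) o y : (forall z, hits o z -> B z) ->
  run h s y <= run (step h o) s y <= run h s y + (runB B s y)%:Z.
Proof.
move=> oB; rewrite (run_mono _ (step_ge h o)) /=.
case: (boolP (runB B s y)) => [_|nB].
  rewrite -run_shift; apply: run_mono => z.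
  by have := step_le h o z; case: (hits o z) => /=; lia.
rewrite (run_local (h := h) (g := step h o) (B := B)) ?addr0 // => z zB.
by rewrite /step ifF //; apply: contraNF zB; exact: oB.
Qed.

Definition rotate (o : slot) : slot :=
  omap (fun x : 'I_period => inZp x.+1) o.

Lemma hits_rotate o y : hits (rotate o) (y + 1) = hits o y.
Proof.
case: o => //= x; rewrite addrAC.
have : x%:Z < period%:Z by rewrite ltz_nat.
have n0 : (period%:Z : int) != 0 by [].
rewrite -(modzDml (y + L%:Z)).
have := modz_ge0 (y + L%:Z) n0; have := ltz_mod (y + L%:Z) n0.
set m := modz _ _; rewrite gtr0_norm // => mn m0 xn.
case: (eqVneq (m + 1) period%:Z) => [E|ne].
  rewrite E modzz.
  have [|ne'] := ltnP x.+1 period.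
    by move=> lt; rewrite modn_small //; lia.
  have -> : x.+1 = period by lia.
  by rewrite modnn; lia.
rewrite modz_small; last by lia.
have [lt|ge] := ltnP x.+1 period.
  by rewrite modn_small //; lia.
have -> : x.+1 = period by lia.
by rewrite modnn; lia.
Qed.

Lemma rotate_inj : injective rotate.
Proof.
move=> o o' E.
have hh y : hits o y = hits o' y by rewrite -[LHS]hits_rotate -[RHS]hits_rotate E.
have key (x : 'I_period) : hits (Some x) (x%:Z - L%:Z).
  by rewrite /= subrK modz_small // ltz_nat ltn_ord.
case: o o' hh {E} => [x|] [x'|] // hh.
- have := hh (x%:Z - L%:Z); rewrite key /= subrK modz_small ?ltz_nat ?ltn_ord//.
  by move=> /esym/eqP[] /val_inj ->.
- by have := hh (x%:Z - L%:Z); rewrite key.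
- by have := hh (x'%:Z - L%:Z); rewrite key.
Qed.

Lemma step_rotate h o y :
  step (fun z => h (z - 1)) (rotate o) (y + 1) = step h o y.
Proof.
rewrite /step hits_rotate !rsos_updateE /local_min.
by rewrite !addrK.
Qed.

Lemma run_rotate h s y :
  run (fun z => h (z - 1)) (map rotate s) (y + 1) = run h s y.
Proof.
elim: s h => [|o s IH] h /=; first by rewrite addrK.
rewrite -IH; apply: eq_run => z.
by rewrite -[in LHS](subrK 1 z) step_rotate.
Qed.

End Dynamics.

(** * Translation invariance, growth and propagation in the random chain *)

Lemma big_option (V : nmodType) (T : finType) (F : option T -> V) :
  \sum_o F o = F None + \sum_x F (Some x).
Proof.
rewrite (bigD1 None) //=; congr (_ + _).
rewrite (reindex_omap (fun x : T => Some x) id) /=; last by case.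
by apply: eq_bigl => x; rewrite eqxx.
Qed.

(** The two sides of the centre of a period contribute equally. *)
Lemma sum_centered (V : nmodType) (L : nat) (phi : nat -> V) :
  \sum_(x < period L) phi `|x%:Z - L%:Z|%N =
  phi 0%N + (\sum_(j < L) phi j.+1 + \sum_(j < L) phi j.+1).
Proof.
rewrite -(big_mkord xpredT (fun x => phi `|x%:Z - L%:Z|%N)) /period.
rewrite (@big_cat_nat _ _ _ L) /=; [|by []|by lia].
rewrite big_nat_rev /= (big_ltn (m := L)) /=; last by lia.
rewrite subrr absz0 addrCA; congr (_ + (_ + _)).
  rewrite big_mkord; apply: eq_bigr => i _; congr phi; have := ltn_ord i; lia.
rewrite -{1}(add0n L.+1) big_addn big_mkord.
have -> : (L.*2.+1 - L.+1 = L)%N by lia.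
by apply: eq_bigr => i _; congr phi; lia.
Qed.

Section Chain.
Variables (R : realType) (L : nat) (p : R).
Local Notation n := (period L).
Hypothesis p_gt0 : 0 < p.
Hypothesis pn_le : p * n%:R <= 1 / 2.

Definition weight (o : slot L) : R := if o is Some _ then p else 1 - p * n%:R.

Local Notation E1 := (expect1 weight).
Local Notation Ex := (expect weight).

Lemma weight_ge0 o : 0 <= weight o.
Proof. by case: o => [x|]; rewrite /weight; [exact: ltW | move: pn_le; lra]. Qed.

Lemma expect1E (G : slot L -> R) :
  E1 G = (1 - p * n%:R) * G None + p * \sum_x G (Some x).
Proof. by rewrite /expect1 big_option mulr_sumr. Qed.

Lemma weight_sum : \sum_o weight o = 1.
Proof. rewrite big_option /weight sumr_const card_ord.
by rewrite -[p *+ _]mulr_natr subrK.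
Qed.

Let ExC k c : Ex k (fun=> c) = c. Proof. exact: expect_cst weight_sum k c. Qed.
Let leEx k := @le_expect R _ weight weight_ge0 k.
Let expect_ge0 k := @expect_ge0 R _ weight weight_ge0 k.
Let leE1 := @le_expect1 R _ weight weight_ge0.
Let E1C c : E1 (fun=> c) = c. Proof. exact: expect1_cst weight_sum c. Qed.

Lemma sum_hits y : \sum_(x : 'I_n) (hits (Some x) y)%:R = 1 :> R.
Proof.
have n0 : (n%:Z : int) != 0 by [].
have := modz_ge0 (y + L%:Z) n0; have := ltz_mod (y + L%:Z) n0.
rewrite /hits; set m := modz _ _ => m1 m2.
have mn : (`|m| < n)%N by lia.
rewrite (bigD1 (Ordinal mn)) //= big1 ?addr0; first by rewrite gez0_abs ?eqxx.
move=> x xm; case: eqP => // mx; case/eqP: xm; apply: val_inj => /=.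
by rewrite mx.
Qed.

Lemma expect1_hits y c : E1 (fun o => (hits o y)%:R * c) = p * c.
Proof.
by rewrite expect1E /= mul0r mulr0 add0r -mulr_suml sum_hits mul1r.
Qed.

Lemma expect_rotate k (G : seq (slot L) -> R) :
  Ex k (fun s => G (map (@rotate L) s)) = Ex k G.
Proof.
elim: k G => [|k IH] G //=.
transitivity (E1 (fun o => Ex k (fun s => G (rotate o :: s)))).
  by apply: eq_expect1 => o; rewrite -(IH (fun s => G (rotate o :: s))).
rewrite [RHS]/expect1 (reindex_inj (@rotate_inj L)) /=.
by apply: eq_bigr => o _; congr (_ * _); case: o.
Qed.

(** The flat surface and the law of the slots are both invariant under
translations. *)
Lemma expect_translate k (G : int -> R) y :
  Ex k (fun s => G (run flat s y)) = Ex k (fun s => G (run flat s 0)).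
Proof.
have up z : Ex k (fun s => G (run flat s (z + 1))) = Ex k (fun s => G (run flat s z)).
  rewrite -expect_rotate; apply: eq_expect => s _; congr G; exact: (run_rotate flat).
have nat_up (j : nat) z : Ex k (fun s => G (run flat s (z + j%:Z))) =
    Ex k (fun s => G (run flat s z)).
  elim: j => [|j IH]; first by rewrite addr0.
  by rewrite -IH -(up (z + j%:Z)); have -> : z + j.+1%:Z = z + j%:Z + 1 by lia.
have [y0|y0] := leP 0 y.
  by rewrite -[in RHS](nat_up `|y|%N 0); have -> : 0 + `|y|%N%:Z = y by lia.
by rewrite -(nat_up `|y|%N y); have -> : y + `|y|%N%:Z = 0 by lia.
Qed.

Lemma expR1_ge2 : 2 <= expR (1 : R).
Proof. by apply: le_trans (expR_ge1Dx _); lra. Qed.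

Lemma expRN2_le : expR (- 2 : R) <= 1 / 4.
Proof.
have h := expR1_ge2.
have : expR (- 2 : R) * (expR 1 * expR 1) = 1.
  by rewrite -!expRD -[RHS]expR0; congr expR; lra.
have e4 : 4 <= expR (1 : R) * expR 1 by nra.
have e2 := expR_gt0 (- 2 : R).
have : expR (- 2 : R) * 4 <= expR (- 2 : R) * (expR 1 * expR 1) by rewrite ler_pM2l.
by move=> + E; rewrite E; lra.
Qed.

(** With [g y = exp (- 2 h y)], a site which is not a local minimum satisfies
[g y <= exp (- 2) * (g (y - 1) + g (y + 1))]. Taking expectations and using
translation invariance, the sites which are not local minima carry at most half
of [E g], so that a ring decreases [E g] by a fixed fraction. *)
Lemma expect_expR_flat k :
  Ex k (fun s => expR (- 2 * (run flat s 0)%:~R)) <= expR (- (3 / 8) * p * k%:R).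
Proof.
pose g (s : seq (slot L)) y : R := expR (- 2 * (run flat s y)%:~R).
rewrite -/(g _ 0).
elim: k => [|k IH]; first by rewrite /= /g /= mulr0 !mulr0 expR0.
have q4 := expRN2_le; have q0 := expR_gt0 (- 2 : R).
set q := expR (- 2) in q4 q0.
pose m s : R := (local_min (run flat s) 0)%:R * g s 0.
have gk y : Ex k (g ^~ y) = Ex k (g ^~ 0).
  exact: (expect_translate k (fun z => expR (- 2 * z%:~R)) y).
(* a site is a local minimum or has a lower neighbour *)
have gm : Ex k (g ^~ 0) <= Ex k m + q * (Ex k (g ^~ 1) + Ex k (g ^~ (-1))).
  rewrite -expectD -expectZ -expectD; apply: leEx => s _; rewrite /m.
  case: (boolP (local_min _ _)) => [_|].
    by rewrite mul1r lerDl; rewrite mulr_ge0 ?addr_ge0 ?expR_ge0.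
  rewrite mul0r add0r /local_min negb_and -!ltNge add0r sub0r => /orP lt.
  have key (a b : int) : a < b -> expR (- 2 * b%:~R) <= q * expR (- 2 * a%:~R).
    move=> ab; rewrite -expRD ler_expR.
    have : (a + 1)%:~R <= b%:~R :> R by rewrite ler_int; lia.
    rewrite intrD; lra.
  have g0 y : 0 <= q * g s y by rewrite mulr_ge0 ?expR_ge0.
  have := g0 1; have := g0 (-1); rewrite mulrDr.
  by case: lt => lt ? ?; have {lt} : g s 0 <= _ := key _ _ lt;
    rewrite -?/(g s 1) -?/(g s (-1)); lra.
rewrite !gk in gm.
have -> : Ex k.+1 (g ^~ 0) = Ex k (g ^~ 0) - p * (1 - q) * Ex k m.
  rewrite expect_rcons -expectZ -expectB; apply: eq_expect => s _.
  rewrite -mulrA -(expect1_hits 0) -[X in X - _](E1C (g s 0)) /expect1 -sumrB.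
  apply: eq_bigr => o _; rewrite -mulrBr; congr (_ * _).
  rewrite /g run_rcons /step /m /g; case: (hits o 0); last by rewrite mul0r subr0.
  rewrite mul1r rsos_updateE; case: (local_min _ 0); last by rewrite mul0r mulr0 !subr0.
  by rewrite mulr1n mul1r intrD mulrDr mulr1 expRD -/q; ring.
set a := Ex k (g ^~ 0) in IH gm *; set b := Ex k m in gm *.
have a0 : 0 <= a by apply: expect_ge0 => s _; exact: expR_ge0.
(* at least half of the weight sits on local minima, since 2 * exp (- 2) <= 1 / 2 *)
have b2 : a / 2 <= b by nra.
apply: (@le_trans _ _ (a * (1 - 3 / 8 * p))).
  have p0 := p_gt0.
  have h1 : p * (3 / 4) <= p * (1 - q) by rewrite ler_pM2l //; lra.
  have h2 : p * (3 / 4) * (a / 2) <= p * (1 - q) * b.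
    by apply: ler_pM => //; nra.
  by nra.
apply: (@le_trans _ _ (a * expR (- (3 / 8) * p))).
  by rewrite ler_wpM2l //; apply: le_trans (expR_ge1Dx _); lra.
apply: le_trans (ler_wpM2r (expR_ge0 _) IH) _.
by rewrite -expRD ler_expR -natr1; lra.
Qed.

(** Growth rate of the contamination measured with the weight [exp (2 * |y|)]: the
two neighbours of [y] have together at most [2 * exp 2] times the weight of [y]. *)
Definition speed : R := 2 * expR 2.

Lemma speed_ge1 : 1 <= speed.
Proof.
rewrite /speed; have : 1 + 2 <= expR (2 : R) by exact: expR_ge1Dx.
by lra.
Qed.

(** A weight dominating the initial set is multiplied by at most
[1 + speed * p <= exp (speed * p)] in each slot. This is finite speed of
propagation: contamination at distance [d] reaches the origin within [k] slots
with probability at most [exp (speed * p * k - 2 * d)]. *)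
Lemma expect_runB k (B : int -> bool) (C : R) y : 0 <= C ->
  (forall z, (B z)%:R <= C * expR (2 * `|z|%N%:R)) ->
  Ex k (fun s => (runB B s y)%:R) <= C * expR (2 * `|y|%N%:R) * expR (speed * p * k%:R).
Proof.
move=> C0 hB; elim: k y => [|k IH] y; first by rewrite /= mulr0 expR0 mulr1.
rewrite expect_rcons.
apply: (@le_trans _ _ (Ex k (fun s => (runB B s y)%:R) +
   p * (Ex k (fun s => (runB B s (y + 1))%:R) + Ex k (fun s => (runB B s (y - 1))%:R)))).
  rewrite -expectD -expectZ -expectD; apply: leEx => s _.
  rewrite -[X in X + _]E1C -(expect1_hits y) -expect1D; apply: leE1 => o.
  rewrite runB_rcons /stepB.
  case: (runB B s y); case: (hits o y); case: (runB B s (y + 1));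
    by case: (runB B s (y - 1)); rewrite /= ?mulr0n ?mulr1n; lra.
have e2 := expR_gt0 (2 : R).
have nb z : (`|z|%N <= `|y|%N + 1)%N ->
    Ex k (fun s => (runB B s z)%:R) <=
    C * (expR (2 * `|y|%N%:R) * expR 2) * expR (speed * p * k%:R).
  move=> zy; apply: le_trans (IH z) _; rewrite ler_wpM2r ?expR_ge0 // ler_wpM2l //.
  rewrite -expRD ler_expR.
  have : `|z|%N%:R <= (`|y|%N + 1)%:R :> R by rewrite ler_nat.
  by rewrite natrD; lra.
have h0 := IH y.
have h1 := nb (y + 1) ltac:(lia).
have h2 := nb (y - 1) ltac:(lia).
have -> : speed * p * k.+1%:R = speed * p * k%:R + speed * p by rewrite -natr1; ring.
rewrite expRD.
set c := C * expR (2 * _) in h0 *; set e := expR (speed * p * k%:R) in h0 h1 h2 *.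
have ce0 : 0 <= c * e by rewrite !mulr_ge0 ?expR_ge0.
have up : c * e * (1 + speed * p) <= c * e * expR (speed * p).
  by rewrite ler_wpM2l // expR_ge1Dx.
rewrite mulrA; apply: le_trans up.
have -> : c * e * (1 + speed * p) = c * e +
    p * (C * (expR (2 * `|y|%N%:R) * expR 2) * e + C * (expR (2 * `|y|%N%:R) * expR 2) * e).
  by rewrite /c /speed; ring.
by apply: lerD => //; rewrite ler_pM2l //; exact: lerD.
Qed.

Lemma expect_hitcount k y : Ex k (fun s => (hitcount s y)%:R) = p * k%:R.
Proof.
elim: k => [|k IH] /=; first by rewrite mulr0.
transitivity (E1 (fun o => (hits o y)%:R * 1 + p * k%:R)).
  apply: eq_expect1 => o; rewrite -IH -[X in X + _](ExC k) -expectD; apply: eq_expect => s _.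
  by rewrite mulr1 -natrD.
by rewrite expect1D expect1_hits E1C -natr1; ring.
Qed.

Lemma expect_hitcount2 k y :
  Ex k (fun s => (hitcount s y)%:R ^+ 2) <= (p * k%:R) ^+ 2 + p * k%:R.
Proof.
elim: k => [|k IH] /=; first by rewrite mulr0 expr0n /= addr0.
rewrite (@eq_expect1 _ _ _ _ (fun o => (hits o y)%:R * (1 + 2 * (p * k%:R)) +
   Ex k (fun s => (hitcount s y)%:R ^+ 2))); last first.
  move=> o; rewrite -(expect_hitcount k y) -expectZ -[X in _ * (X + _)](ExC k) -expectD -expectZ -expectD.
  apply: eq_expect => s _; rewrite natrD; case: (hits o y) => /=; ring.
rewrite expect1D expect1_hits E1C -natr1.
have := sqr_ge0 p; nra.
Qed.

Lemma expect_expR_hitcount k y :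
  Ex k (fun s => expR (hitcount s y)%:R) <= expR (expR 1 * p * k%:R).
Proof.
elim: k => [|k IH] /=; first by rewrite mulr0.
rewrite (@eq_expect1 _ _ _ _ (fun o => Ex k (fun s => expR (hitcount s y)%:R) +
   (hits o y)%:R * ((expR 1 - 1) * Ex k (fun s => expR (hitcount s y)%:R)))); last first.
  move=> o; rewrite -!expectZ -expectD.
  by apply: eq_expect => s _; rewrite natrD expRD; case: (hits o y); rewrite /= ?expR0; ring.
rewrite expect1D expect1_hits E1C.
set a := Ex k _ in IH *.
have a0 : 0 <= a by apply: expect_ge0 => s _; exact: expR_ge0.
apply: (@le_trans _ _ (a * expR (expR 1 * p))).
  have -> : a + p * ((expR 1 - 1) * a) = a * (1 + expR 1 * p - p) by ring.
  rewrite ler_wpM2l //; apply: le_trans (expR_ge1Dx _).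
  by have := p_gt0; lra.
apply: le_trans (ler_wpM2r (expR_ge0 _) IH) _.
by rewrite -expRD ler_expR -natr1; lra.
Qed.

End Chain.

(** * Linear response to the ringing rates *)

Section LinearResponse.
Variables (R : realType) (L : nat) (p : R).
Local Notation n := (period L).
Hypothesis p_gt0 : 0 < p.
Hypothesis pn_le : p * n%:R <= 1 / 2.
Local Notation weight := (@weight R L p).
Local Notation E1 := (expect1 weight).
Local Notation Ex := (expect weight).

Let ExC k c : Ex k (fun=> c) = c. Proof. exact: expect_cst (weight_sum L p) k c. Qed.
Let leEx k := @le_expect R _ weight (weight_ge0 p_gt0 pn_le) k.
Let expect_ge0 k := @expect_ge0 R _ weight (weight_ge0 p_gt0 pn_le) k.
Let leE1 := @le_expect1 R _ weight (weight_ge0 p_gt0 pn_le).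
Let E1C c : E1 (fun=> c) = c. Proof. exact: expect1_cst (weight_sum L p) c. Qed.

Definition height (s : seq (slot L)) : R := (run flat s 0)%:~R.
Definition mean (k : nat) : R := Ex k height.

Definition slot_mean (i k : nat) (o : slot L) : R :=
  Ex i (fun s1 => Ex k (fun s2 => height (s1 ++ o :: s2))).

(** An empty slot only shortens the evolution: this turns the response to a change
of rates in one slot into the growth of the mean height. *)
Lemma slot_mean_None i k : slot_mean i k None = mean (i + k).
Proof.
rewrite /mean expect_cat; apply: eq_expect => s1 _; apply: eq_expect => s2 _.
by rewrite /height !run_cat.
Qed.

Lemma expect1_slot_mean i k : E1 (slot_mean i k) = mean (i + k).+1.
Proof. by rewrite /mean -addnS expect_cat -expect_expect1. Qed.

Lemma slot_mean_le i k o : slot_mean i k None <= slot_mean i k o.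
Proof.
apply: leEx => s1 _; apply: leEx => s2 _.
rewrite /height !run_cat /= ler_int; apply: run_mono => y; exact: step_ge.
Qed.

(** The influence of a ring decays exponentially outside a cone, by
[run_extra] and [expect_runB]. *)
Lemma slot_mean_far i k (x : 'I_n) :
  slot_mean i k (Some x) <= slot_mean i k None +
    expR (speed R * p * k%:R - 2 * `|x%:Z - L%:Z|%N%:R).
Proof.
set d := `|_|%N.
(* among the representatives of a residue the centred one is closest to the origin *)
have dz z : hits (Some x) z -> (d <= `|z|)%N.
  rewrite /d /=; move: (nat_of_ord x) (ltn_ord x) => x' xn /eqP E.
  rewrite leqNgt; apply/negP => lt; rewrite /period in E xn.
  by move: E; rewrite modz_small => [E|]; lia.
rewrite -[X in _ + X](ExC i) -expectD; apply: leEx => s1 _.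
apply: (@le_trans _ _ (Ex k (fun s2 => height (s1 ++ None :: s2) +
  (runB (hits (Some x)) s2 0)%:R))).
  apply: leEx => s2 _; rewrite /height !run_cat /=.
  have /andP[_] := @run_extra L (run flat s1) s2 (hits (Some x)) (Some x) 0 (fun z h => h).
  by rewrite -(ler_int R) intrD.
rewrite expectD lerD2l.
apply: le_trans (@expect_runB _ _ _ p_gt0 pn_le k (hits (Some x)) (expR (- (2 * d%:R))) 0 _ _) _.
- exact: expR_ge0.
- move=> z; case hz: (hits (Some x) z); last by rewrite mulr_ge0 ?expR_ge0.
  rewrite -expRD; apply: le_trans (expR_ge1Dx _).
  have : d%:R <= `|z|%N%:R :> R by rewrite ler_nat dz.
  by rewrite /=; lra.
- by rewrite mulr0 expR0 mulr1 -expRD ler_expR; lra.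
Qed.

Definition in_window (rho : R) (x : 'I_n) : bool := `|x%:Z - L%:Z|%N%:R <= rho.

Definition window_ind (rho : R) (o : slot L) : R :=
  if o is Some x then (in_window rho x)%:R else 0.

Definition window_prob rho : R := E1 (window_ind rho).

Lemma window_probE rho : window_prob rho = p * \sum_x (in_window rho x)%:R.
Proof. by rewrite /window_prob expect1E /= mulr0 add0r. Qed.

Lemma window_prob_le rho : 1 <= rho -> window_prob rho <= 3 * p * rho.
Proof.
move=> rho1; rewrite window_probE.
rewrite (@sum_centered _ L (fun d => (d%:R <= rho)%R%:R : R)).
have h (m : nat) : \sum_(j < m) (j.+1%:R <= rho)%R%:R <= rho /\
    \sum_(j < m) (j.+1%:R <= rho)%R%:R <= m%:R :> R.
  elim: m => [|m [IH1 IH2]]; first by rewrite big_ord0; split; lra.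
  rewrite big_ord_recr /= -!natr1; have := ler0n R m.
  by case: (leP (m%:R + 1) rho) => ? ?; split; rewrite ?mulr1n ?mulr0n; lra.
have [hL _] := h L.
have p0 := p_gt0.
have -> : (0%:R <= rho)%R%:R = 1 :> R by rewrite (le_trans ler01 rho1).
have -> : 3 * p * rho = p * (3 * rho) by ring.
rewrite ler_pM2l //; lra.
Qed.

Lemma sum_expR_far : \sum_(x < n) expR (- `|x%:Z - L%:Z|%N%:R) <= 3 :> R.
Proof.
rewrite (@sum_centered _ L (fun d => expR (- d%:R) : R)) oppr0 expR0.
have h (m : nat) : \sum_(j < m) expR (- j.+1%:R) <= 1 - (2^-1) ^+ m :> R.
  elim: m => [|m IH]; first by rewrite big_ord0 expr0 subrr.
  rewrite big_ord_recr /= exprS.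
  have : expR (- m.+1%:R) <= (2^-1) ^+ m.+1 :> R.
    rewrite -mulrN1 expRM_natl lerXn2r ?nnegrE ?expR_ge0 ?invr_ge0 //.
    rewrite expRN lef_pV2 ?posrE ?expR_gt0 //; exact: expR1_ge2.
  rewrite exprS; lra.
have := h L; have : 0 <= (2^-1 : R) ^+ L by rewrite exprn_ge0.
lra.
Qed.

(** Summed over all sites, the responses [h (Some x) - h None] to a ring amount to
[(E1 h - h None) / p]; the window loses those of the sites outside it, and the
centring costs at most a proportion [p * n] of the total. *)
Lemma window_cov (h : slot L -> R) rho : (forall o, h None <= h o) ->
  (1 - p * n%:R) * (E1 h - h None) -
    p * \sum_(x | ~~ in_window rho x) (h (Some x) - h None) <=
  E1 (fun o => h o * (window_ind rho o - window_prob rho)).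
Proof.
move=> h_le; set b := window_prob rho.
pose D o := h o - h None.
have D0 o : 0 <= D o by rewrite subr_ge0.
have E1D' : E1 h = h None + E1 D.
  by rewrite -[X in X + _]E1C -expect1D; apply: eq_expect1 => o; rewrite /D addrC subrK.
have -> : E1 (fun o => h o * (window_ind rho o - b)) =
    E1 (fun o => D o * window_ind rho o) - b * E1 D.
  transitivity (E1 (fun o => h None * window_ind rho o) +
     (E1 (fun o => - b * D o) + E1 (fun o => D o * window_ind rho o)) - h None * b).
    rewrite -!expect1D -[X in _ - X]E1C -[- E1 _]mulN1r -expect1Z -expect1D.
    by apply: eq_expect1 => o; rewrite /D; ring.
  rewrite !expect1Z -/(window_prob _) -/b; ring.
have -> : E1 h - h None = E1 D by rewrite E1D'; ring.
have b_le : b <= p * n%:R.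
  rewrite /b window_probE ler_pM2l // -[X in _ <= X%:R]card_ord -sumr_const.
  by apply: ler_sum => x _; rewrite lern1 leq_b1.
have ED0 : 0 <= E1 D by rewrite -(E1C 0); apply: leE1.
have -> : E1 (fun o => D o * window_ind rho o) =
    E1 D - p * \sum_(x | ~~ in_window rho x) D (Some x).
  have DN : D None = 0 by rewrite /D subrr.
  rewrite !expect1E /= DN !mulr0 !add0r -mulrBr; congr (_ * _).
  rewrite [X in X - _](bigID (in_window rho)) /= addrK [RHS]big_mkcond /=.
  by apply: eq_bigr => x _; case: ifP; rewrite ?mulr1 ?mulr0.
have := ler_wpM2r ED0 b_le; rewrite /D; lra.
Qed.

(** Half-width of the cone of influence of the origin, [k] slots before the final
time. *)
Definition radius (r : R) (k : nat) : R := r + speed R * p * k%:R.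

Definition slot_score (r : R) (k : nat) (o : slot L) : R :=
  (window_ind (radius r k) o - window_prob (radius r k)) / radius r k.

(** The linear statistic correlated with the height: [size s'] is the number of
slots which remain after the current one, so that the window narrows as the final
time approaches. *)
Fixpoint score (r : R) (s : seq (slot L)) : R :=
  if s is o :: s' then slot_score r (size s') o + score r s' else 0.

(** The discrete version of the integral of [1 / (r + speed * s)], of order the
logarithm of the elapsed time [p * k]. *)
Definition log_sum (r : R) (k : nat) : R := \sum_(j < k) p / radius r j.

Variable r : R.
Hypothesis r_ge1 : 1 <= r.

Lemma speed_gt0 : 0 < speed R.
Proof. exact: lt_le_trans (speed_ge1 R). Qed.

Lemma radius_ge1 k : 1 <= radius r k.
Proof.
rewrite /radius; apply: le_trans r_ge1 _; rewrite lerDl.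
by rewrite !mulr_ge0 ?(ltW speed_gt0) ?(ltW p_gt0).
Qed.

Lemma radius_gt0 k : 0 < radius r k.
Proof. exact: lt_le_trans (radius_ge1 k). Qed.

Lemma expect1_slot_score k : E1 (slot_score r k) = 0.
Proof.
rewrite /slot_score; transitivity ((radius r k)^-1 * E1 (fun o =>
  window_ind (radius r k) o + (- window_prob (radius r k)))).
  by rewrite -expect1Z; apply: eq_expect1 => o; rewrite mulrC.
by rewrite expect1D E1C -/(window_prob _) subrr mulr0.
Qed.

Lemma expect1_slot_score2 k : E1 (fun o => slot_score r k o ^+ 2) <= 3 * (p / radius r k).
Proof.
have rk := radius_gt0 k; have rk1 := radius_ge1 k.
set rho := radius r k in rk rk1 *; set b := window_prob rho.
have -> : E1 (fun o => slot_score r k o ^+ 2) = rho ^- 2 * (b - b ^+ 2).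
  transitivity (E1 (fun o => rho ^- 2 * ((1 - 2 * b) * window_ind rho o + b ^+ 2))).
    apply: eq_expect1 => o; rewrite /slot_score -/rho -/b exprMn exprVn mulrC; congr (_ * _).
    by case: o => [x|] /=; [case: (in_window _ _) => /=|]; ring.
  by rewrite expect1Z expect1D expect1Z E1C -/(window_prob _) -/b; ring.
have b_le := window_prob_le rk1; rewrite -/b in b_le.
rewrite mulrC ler_pdivrMr ?exprn_gt0 //.
have -> : 3 * (p / rho) * rho ^+ 2 = 3 * p * rho by field; rewrite gt_eqF.
have := sqr_ge0 b; lra.
Qed.

Lemma expect_score k : Ex k (score r) = 0.
Proof.
elim: k => [|k IH] //=.
rewrite -(expect1_slot_score k); apply: eq_expect1 => o.
rewrite -[RHS]addr0 -IH -[X in _ = X + _](ExC k) -expectD.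
by apply: eq_expect => s ->.
Qed.

(** The slots are independent and each term is centred, so the variances add up; a
window of half-width [rho] has probability at most [3 * p * rho], which the factor
[1 / rho] turns into a variance of order [p / rho]. *)
Lemma expect_score2 k : Ex k (fun s => score r s ^+ 2) <= 3 * log_sum r k.
Proof.
elim: k => [|k IH] /=; first by rewrite /log_sum big_ord0 expr0n mulr0.
rewrite (@eq_expect1 _ _ _ _ (fun o => slot_score r k o ^+ 2 + Ex k (fun s => score r s ^+ 2))).
  rewrite expect1D E1C /log_sum big_ord_recr /= mulrDr addrC.
  by apply: lerD => //; exact: expect1_slot_score2.
move=> o; set c := slot_score r k o.
transitivity (Ex k (fun s => (c ^+ 2 + 2 * c * score r s) + score r s ^+ 2)).
  by apply: eq_expect => s ->; rewrite -/c; ring.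
by rewrite expectD expectD ExC expectZ expect_score mulr0 addr0.
Qed.

(** Up to the factor [1 - p * n] and the exponentially small influence of sites
outside the window, the height and the term of one slot have a covariance at least
equal to the growth of the mean height divided by the half-width of the window. The
point is that the growth [mean (i + k).+1 - mean (i + k)] depends on [i + k] only. *)
Lemma slot_cov i k :
  ((1 - p * n%:R) * (mean (i + k).+1 - mean (i + k)) - 3 * p * expR (- r)) / radius r k <=
  E1 (fun o => slot_mean i k o * slot_score r k o).
Proof.
have rk := radius_gt0 k.
rewrite ler_pdivrMr // [X in _ <= X]mulrC -expect1Z.
rewrite (@eq_expect1 _ _ _ _ (fun o => slot_mean i k o *
  (window_ind (radius r k) o - window_prob (radius r k)))); last first.
  by move=> o; rewrite /slot_score mulrCA; congr (_ * _); rewrite mulrC divfK ?gt_eqF.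
apply: le_trans (window_cov _ (@slot_mean_le i k)).
rewrite expect1_slot_mean slot_mean_None lerD2l lerN2 [3 * p]mulrC -mulrA ler_pM2l //.
apply: (@le_trans _ _ (\sum_(x < n) expR (- `|x%:Z - L%:Z|%N%:R) * expR (- r))); last first.
  by rewrite -mulr_suml ler_wpM2r ?expR_ge0 //; exact: sum_expR_far.
rewrite big_mkcond /=; apply: ler_sum => x _.
case: ifP => [far|_]; last by rewrite mulr_ge0 ?expR_ge0.
have := slot_mean_far i k x; rewrite slot_mean_None -lerBlDl => /le_trans; apply.
rewrite -expRD ler_expR.
move: far; rewrite /in_window -ltNge /radius; lra.
Qed.

(** Sum of [slot_cov] over the last [k] slots, obtained by moving the slots one by
one from the second group to the first. *)
Lemma height_score_cov (D : R) M i k : (i + k = M.+1)%N ->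
  D <= (1 - p * n%:R) * (mean M.+1 - mean M) - 3 * p * expR (- r) ->
  \sum_(j < k) D / radius r j <=
  Ex i (fun s1 => Ex k (fun s2 => height (s1 ++ s2) * score r s2)).
Proof.
move=> + hD; elim: k i => [|k IH] i ik.
  rewrite big_ord0; apply: expect_ge0 => s1 _ /=; by rewrite mulr0.
have ik' : (i.+1 + k = M.+1)%N by lia.
have ikM : (i + k = M)%N by lia.
have -> : Ex i (fun s1 => Ex k.+1 (fun s2 => height (s1 ++ s2) * score r s2)) =
  E1 (fun o => slot_mean i k o * slot_score r k o) +
  Ex i.+1 (fun s1 => Ex k (fun s2 => height (s1 ++ s2) * score r s2)).
  rewrite expect_rcons.
  rewrite (@eq_expect1 _ _ _ (fun o => slot_mean i k o * slot_score r k o)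
   (fun o => Ex i (fun s1 => Ex k (fun s2 => height (s1 ++ o :: s2)) * slot_score r k o))); last first.
    by move=> o; rewrite /slot_mean expectZr.
  rewrite -(expect_expect1 weight i
    (fun o s1 => Ex k (fun s2 => height (s1 ++ o :: s2)) * slot_score r k o)).
  rewrite -expectD; apply: eq_expect => s1 _ /=.
  rewrite -expect1D; apply: eq_expect1 => o.
  rewrite -expectZr -expectD; apply: eq_expect => s2 sk.
  by rewrite sk cat_rcons mulrDr.
rewrite big_ord_recr /= addrC; apply: lerD; last exact: (IH _ ik').
apply: le_trans (slot_cov i k); rewrite ikM.
by rewrite ler_pM2r ?invr_gt0 ?radius_gt0.
Qed.

End LinearResponse.

Section LinearResponseConsequence.
Variables (R : realType) (L : nat) (p : R).
Local Notation n := (period L).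
Hypothesis p_gt0 : 0 < p.
Hypothesis pn_le : p * n%:R <= 1 / 2.
Local Notation weight := (@weight R L p).
Local Notation Ex := (expect weight).
Local Notation height := (@height R L).
Local Notation mean := (mean L p).

Let ExC k c : Ex k (fun=> c) = c. Proof. exact: expect_cst (weight_sum L p) k c. Qed.
Let expect_ge0 k := @expect_ge0 R _ weight (weight_ge0 p_gt0 pn_le) k.

(** Cauchy-Schwarz for the height and the score: the covariance is of order [H],
the variance of the score of order [H], where [H] is the sum in the conclusion.
With [r = 311] the influence of far sites, at most [3 * exp (- r) <= 1 / 104], is
at most half of the main contribution [1 / 52]. *)
Lemma linear_response M c : p / 26 <= mean M.+1 - mean M ->
  log_sum p 311 M.+1 <= (3 * 104 ^+ 2) * Ex M.+1 (fun s => (height s - c) ^+ 2).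
Proof.
move=> hv; set H := log_sum _ _ _; set V := Ex _ _.
have r1 : 1 <= 311 :> R by lra.
have H0 : 0 <= H.
  apply: sumr_ge0 => j _; rewrite divr_ge0 ?(ltW p_gt0) //.
  exact/ltW/(radius_gt0 p_gt0 r1).
have e311 : 3 * expR (- 311 : R) <= 1 / 104.
  rewrite expRN.
  have h : 1 + 311 <= expR (311 : R) := expR_ge1Dx 311.
  have e0 := expR_gt0 (311 : R).
  rewrite ler_pdivrMr //; lra.
have cov : H / 104 <= Ex M.+1 (fun s => height s * score p 311 s).
  have := @height_score_cov _ _ _ p_gt0 pn_le 311 r1 (p / 104) M 0 M.+1 erefl.
  have -> : \sum_(j < M.+1) p / 104 / radius p 311 j = H / 104.
    by rewrite /H /log_sum mulr_suml; apply: eq_bigr => j _; rewrite mulrAC.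
  apply.
  have : (1 / 2) * (p / 26) <= (1 - p * n%:R) * (mean M.+1 - mean M).
    apply: ler_pM => //; first by rewrite divr_ge0 ?(ltW p_gt0).
    by move: pn_le; lra.
  have : p * (3 * expR (- 311)) <= p * (1 / 104) by rewrite ler_pM2l.
  by lra.
have CS := expect_CauchySchwarz (weight_ge0 p_gt0 pn_le) M.+1 (fun s => height s - c) (score p 311).
have E : Ex M.+1 (fun s => (height s - c) * score p 311 s) =
         Ex M.+1 (fun s => height s * score p 311 s).
  transitivity (Ex M.+1 (fun s => height s * score p 311 s + (- c) * score p 311 s)).
    by apply: eq_expect => s _; ring.
  by rewrite expectD expectZ expect_score mulr0 addr0.
rewrite E -/V in CS; have S2 := expect_score2 L p_gt0 r1 M.+1; rewrite -/H in S2.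
have V0 : 0 <= V by apply: expect_ge0 => s _; exact: sqr_ge0.
set Cv := Ex M.+1 (fun s => height s * _) in cov CS.
have CH : (H / 104) ^+ 2 <= Cv ^+ 2 by rewrite lerXn2r ?nnegrE //; lra.
have VH : V * Ex M.+1 (fun s => score p 311 s ^+ 2) <= V * (3 * H) by rewrite ler_wpM2l.
have [HP|HN] := ltP 0 H; last by lra.
have : H * (H / 104 ^+ 2) <= H * (3 * V) by nra.
rewrite ler_pM2l //; lra.
Qed.

End LinearResponseConsequence.

(** * Growth out of a nearly flat surface *)

Section Growth.
Variables (R : realType) (L : nat) (p : R).
Local Notation n := (period L).
Hypothesis p_gt0 : 0 < p.
Hypothesis pn_le : p * n%:R <= 1 / 2.
Local Notation weight := (@weight R L p).
Local Notation Ex := (expect weight).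
Local Notation height := (@height R L).
Local Notation mean := (mean L p).

Let ExC k c : Ex k (fun=> c) = c. Proof. exact: expect_cst (weight_sum L p) k c. Qed.
Let expect_ge0 k := @expect_ge0 R _ weight (weight_ge0 p_gt0 pn_le) k.
Let leEx k := @le_expect R _ weight (weight_ge0 p_gt0 pn_le) k.

Definition outside (rho : nat) (z : int) : bool := (rho < `|z|)%N.

(** Points spaced by [lam], numbered from [- rho * lam] to [rho * lam]: a Lipschitz
function is controlled on the whole interval by its values there. *)
Definition grid_point (rho lam : nat) (i : nat) : int := (i%:Z - rho%:Z) * lam%:Z.

Lemma grid_cover rho lam (y : int) : (0 < lam)%N -> ~~ outside (rho * lam) y ->
  exists i : 'I_(period rho), (`|y - grid_point rho lam i| < lam)%N.
Proof.
move=> lam0; rewrite /outside -leqNgt => yr.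
pose a := (`|y| %/ lam)%N.
have ar : (a <= rho)%N by rewrite /a -(mulnK rho lam0) leq_div2r.
have Ea := divn_eq `|y|%N lam; have Em := ltn_pmod `|y|%N lam0.
rewrite -/a in Ea; set b := (_ %% _)%N in Ea Em.
have [y0|y0] := leP 0 y.
  have ip : (rho + a < period rho)%N by rewrite /period; lia.
  exists (Ordinal ip); rewrite /grid_point /= PoszD addrAC subrr add0r.
  have -> : y = (a * lam)%N%:Z + b%:Z by lia.
  by rewrite -PoszM; lia.
have ip : (rho - a < period rho)%N by rewrite /period; lia.
exists (Ordinal ip); rewrite /grid_point /=.
have -> : (rho - a)%N%:Z - rho%:Z = - a%:Z by lia.
have -> : y = - ((a * lam)%N%:Z + b%:Z) by lia.
by rewrite mulNr -PoszM; lia.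
Qed.

(** If the surface is within [lam] of [mu] at the grid points, it is above
[mu - 2 * lam] on the interval and, up to contamination from outside, it stays above
the surface started flat at that level. If that surface has risen by more than [ell]
the bound follows; if one of these conditions fails, the corresponding
subtracted term is at least 1 and the left-hand side is at most 0. *)
Lemma growth_pathwise (h : int -> int) (s : seq (slot L)) (mu ell : R) (rho lam : nat) :
  lipschitz1 h -> (0 < lam)%N -> 3 * lam%:R <= ell ->
  (ell - 3 * lam%:R) *
    (1 - (\sum_(i < period rho) ((h (grid_point rho lam i))%:~R - mu) ^+ 2) / lam%:R ^+ 2
       - (runB (outside (rho * lam)) s 0)%:R
       - expR (2 * ell - 2 * (run flat s 0)%:~R)) <=
  (run h s 0)%:~R - (h 0)%:~R.
Proof.
move=> hl lam0 ell3; set S := \sum_(i < _) _.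
have lamR : 0 < lam%:R :> R by rewrite ltr0n.
have lam2 : 0 < lam%:R ^+ 2 :> R by rewrite exprn_gt0.
have S0 : 0 <= S by apply: sumr_ge0 => i _; exact: sqr_ge0.
have S0' : 0 <= S / lam%:R ^+ 2 by rewrite divr_ge0 // ltW.
have e0 := expR_ge0 (2 * ell - 2 * (run flat s 0)%:~R : R).
have up : (h 0)%:~R <= (run h s 0)%:~R :> R by rewrite ler_int run_ge.
case: (boolP [exists i : 'I_(period rho), lam%:R <= `|(h (grid_point rho lam i))%:~R - mu|]).
  case/existsP => i hi.
  have : 1 <= S / lam%:R ^+ 2.
    rewrite ler_pdivlMr // mul1r /S (bigD1 i) //= -[X in X <= _]addr0.
    apply: lerD; last by apply: sumr_ge0 => j _; exact: sqr_ge0.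
    by rewrite -[X in _ <= X]real_normK ?num_real // lerXn2r ?nnegrE.
  by case: (runB _ s 0) => /=; rewrite ?mulr1n ?mulr0n; nra.
rewrite negb_exists => /forallP near_mu.
have near (i : 'I_(period rho)) : `|(h (grid_point rho lam i))%:~R - mu| < lam%:R.
  by have := near_mu i; rewrite -ltNge.
case: (boolP (runB _ s 0)) => [_|clean].
  by rewrite /= mulr1n; nra.
have [low|high] := leP (run flat s 0)%:~R ell.
  have : 1 <= expR (2 * ell - 2 * (run flat s 0)%:~R).
    by apply: le_trans (expR_ge1Dx _); lra.
  by rewrite /= mulr0n; nra.
have lowb y : ~~ outside (rho * lam) y -> mu - 2 * lam%:R <= (h y)%:~R.
  move=> /(grid_cover lam0)[i iy].
  have := near i; rewrite ltr_norml => /andP[+ _].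
  have := lipschitz_dist y (grid_point rho lam i) hl => d1.
  have : (h (grid_point rho lam i))%:~R - lam%:R <= (h y)%:~R :> R.
    rewrite -[lam%:R]/(lam%:Z%:~R) -intrB ler_int; lia.
  lra.
(* the surface is raised to level c0 outside the interval, which is not felt at the origin *)
pose c0 := Num.ceil (mu - 2 * lam%:R).
pose psi y := Num.max (h y) c0.
have agree y : ~~ outside (rho * lam) y -> h y = psi y.
  by move=> /lowb; rewrite -ceil_le_int => hc; rewrite /psi max_l.
rewrite (run_local agree clean).
have : c0 + run flat s 0 <= run psi s 0.
  rewrite addrC -run_shift; apply: run_mono => y.
  by rewrite /flat add0r /psi le_max lexx orbT.
rewrite -(ler_int R) intrD.
have := ceil_ge (mu - 2 * lam%:R); rewrite -/c0.
have rp : (rho < period rho)%N by rewrite /period; lia.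
have := near (Ordinal rp); rewrite /grid_point /= subrr mul0r.
rewrite ltr_norml => /andP[_ h0].
rewrite mulr0n.
set x := _ / _ in S0' *; set e := expR _ in e0 *.
have : (ell - 3 * lam%:R) * (1 - x - 0 - e) <= ell - 3 * lam%:R by nra.
lra.
Qed.

(** Expectation of [growth_pathwise]: the deviations at the grid points all have the
same mean square by translation invariance, so Chebyshev's inequality and a
union bound are contained in the first error term. *)
Lemma growth M m (mu ell : R) (rho lam : nat) :
  (0 < lam)%N -> 3 * lam%:R <= ell ->
  (ell - 3 * lam%:R) *
    (1 - (period rho)%:R * Ex M (fun s => (height s - mu) ^+ 2) / lam%:R ^+ 2
       - expR (speed R * p * m%:R - 2 * (rho * lam)%:R)
       - expR (2 * ell - 3 / 8 * p * m%:R)) <= mean (M + m) - mean M.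
Proof.
move=> lam0 ell3; set V := Ex M _.
rewrite /mean expect_cat.
pose S (s1 : seq (slot L)) : R :=
  \sum_(i < period rho) ((run flat s1 (grid_point rho lam i))%:~R - mu) ^+ 2.
have ES : Ex M S = (period rho)%:R * V.
  rewrite /S expect_sum.
  rewrite (eq_bigr (fun=> V)) ?sumr_const ?card_ord ?[RHS]mulr_natl // => i _.
  exact: (expect_translate L p M (fun z => (z%:~R - mu) ^+ 2)).
set K := ell - 3 * lam%:R.
have K0 : 0 <= K by rewrite subr_ge0.
set lam2 : R := lam%:R ^+ 2.
pose a := Ex m (fun s => (runB (outside (rho * lam)) s 0)%:R).
pose b := Ex m (fun s => expR (2 * ell - 2 * (run flat s 0)%:~R)).
have a_le : a <= expR (speed R * p * m%:R - 2 * (rho * lam)%:R).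
  apply: le_trans (@expect_runB _ _ _ p_gt0 pn_le m _ (expR (- (2 * (rho * lam)%:R))) 0 _ _) _.
  - exact: expR_ge0.
  - move=> z; case hz: (outside _ z); last by rewrite mulr_ge0 ?expR_ge0.
    rewrite -expRD; apply: le_trans (expR_ge1Dx _).
    have : (rho * lam)%:R <= `|z|%N%:R :> R by rewrite ler_nat ltnW.
    by rewrite mulr1n; lra.
  - by rewrite mulr0 expR0 mulr1 -expRD ler_expR; lra.
have b_le : b <= expR (2 * ell - 3 / 8 * p * m%:R).
  rewrite /b (@eq_expect _ _ _ _ _ (fun s => expR (2 * ell) * expR (- 2 * (run flat s 0)%:~R))).
    rewrite expectZ; apply: le_trans (ler_wpM2l (expR_ge0 _) (expect_expR_flat p_gt0 pn_le m)) _.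
    by rewrite -expRD ler_expR; lra.
  by move=> s _; rewrite -expRD mulNr.
apply: (@le_trans _ _ (K * (1 - (period rho)%:R * V / lam2 - a - b))).
  by rewrite ler_wpM2l //; lra.
apply: (@le_trans _ _ (Ex M (fun s1 => Ex m (fun s2 =>
   K * (1 - S s1 / lam2 - (runB (outside (rho * lam)) s2 0)%:R
       - expR (2 * ell - 2 * (run flat s2 0)%:~R)))))).
  rewrite (@eq_expect _ _ _ M _ (fun s1 => K * ((1 - a - b) - lam2^-1 * S s1))); last first.
    move=> s1 _; rewrite expectZ expectB expectB ExC -/a -/b; congr (_ * _); ring.
  by rewrite expectZ expectB ExC expectZ ES ler_wpM2l //; lra.
rewrite -expectB; apply: leEx => s1 _.
rewrite -[height s1](ExC m) -expectB; apply: leEx => s2 _.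
rewrite /height run_cat; apply: growth_pathwise => //.
exact/run_lipschitz/flat_lipschitz.
Qed.

End Growth.

(** Comparison with the integral of [1 / (r + speed * s)], through
[ln (1 + x) <= x]. *)
Lemma log_sum_ge (R : realType) (p r : R) k : 0 < p -> 1 <= r ->
  (ln (radius p r k) - ln r) / speed R <= log_sum p r k.
Proof.
move=> p0 r1; have s0 := speed_gt0 R.
elim: k => [|k IH].
  by rewrite /radius mulr0 addr0 subrr mul0r /log_sum big_ord0.
rewrite /log_sum big_ord_recr /= -/(log_sum p r k).
have rk := radius_gt0 p0 r1 k.
have x0 : 0 < speed R * p / radius p r k by rewrite divr_gt0 // mulr_gt0.
have -> : radius p r k.+1 = radius p r k * (1 + speed R * p / radius p r k).
  rewrite mulrDr mulr1 mulrC divfK ?gt_eqF // /radius -natr1; ring.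
rewrite lnM ?posrE //; last by rewrite addr_gt0.
have : ln (1 + speed R * p / radius p r k) <= speed R * p / radius p r k.
  by apply: le_ln1Dx; apply: lt_trans x0; lra.
rewrite addrAC mulrDl => h; apply: lerD => //.
rewrite ler_pdivrMr //; apply: le_trans h _.
by rewrite le_eqVlt; apply/orP; left; apply/eqP; ring.
Qed.

Lemma log_sum_mono (R : realType) (p r : R) k j : 0 < p -> 1 <= r ->
  log_sum p r k <= log_sum p r (k + j).
Proof.
move=> p0 r1; elim: j => [|j IH]; first by rewrite addn0.
rewrite addnS; apply: le_trans IH _; rewrite /log_sum big_ord_recr /= lerDl.
by rewrite divr_ge0 ?(ltW p0) // ltW // radius_gt0.
Qed.

Lemma telescope_lt (R : realDomainType) (u : nat -> R) (c : R) M m : (0 < m)%N ->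
  (forall j, (j < m)%N -> u (M + j).+1 - u (M + j)%N < c) -> u (M + m)%N - u M < m%:R * c.
Proof.
elim: m => // -[|m] IH _ h.
  by have := h 0 isT; rewrite addn0 addn1 mul1r.
have h1 := IH isT (fun j jm => h j (leqW jm)).
have h2 := h m.+1 (ltnSn _).
by rewrite addnS -natr1 mulrDl mul1r; lra.
Qed.

(** * Logarithmic variance of the chain *)

Section DiscreteVariance.
Variable R : realType.

Lemma exists_scale (x : R) : 0 <= x ->
  exists lam : nat, [/\ (0 < lam)%N, x <= lam%:R ^+ 2 & lam%:R ^+ 2 <= 2 * x + 2].
Proof.
move=> x0; exists (Num.truncn (Num.sqrt x)).+1.
have s0 := sqrtr_ge0 x; have sx := sqr_sqrtr x0.
have /andP[h1 h2] := truncn_itv s0.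
set s := Num.sqrt x in s0 sx h1 h2 *; set l := Num.truncn s in h1 h2 *.
have l1 : l.+1%:R = l%:R + 1 :> R by rewrite natr1.
split => //; first by rewrite -sx lerXn2r ?nnegrE // ltW.
have l0 : 0 <= l%:R :> R by [].
by have := sqr_ge0 (s - 1); rewrite l1; nra.
Qed.

(** Let [V] be the mean square deviation from [c], and [lam] an integer of order
[sqrt V + 1]. After about [64 * lam / p] further slots the mean height has grown by at
least [5 / 2 * lam], so in one of them it grows by at least [p / 26], and
[linear_response] applies at that moment. Since the height has moved by a
variable with second moment of order [lam ^+ 2] in between, the mean square deviation at that
moment is at most a multiple of [V + 1]. *)
Lemma discrete_variance : exists2 C : R, 0 < C &
  forall (L : nat) (p : R) (M : nat) (c : R),
    0 < p -> p * (period L)%:R <= 1 / 2 -> (0 < M)%N ->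
    ln (p * M%:R) <= C * (1 + expect (@weight R L p) M (fun s => (height R s - c) ^+ 2)).
Proof.
have s1 := speed_ge1 R.
have [rho rho_ge] : exists rho : nat, 65 * speed R + 8 <= rho%:R.
  by exists (Num.bound (65 * speed R + 8)); rewrite ltW // archi_boundP //; lra.
(* the number of grid points, with a margin that makes Chebyshev's bound at most 1 / 4 *)
pose A : R := 4 * (period rho)%:R.
have A0 : 0 < A by rewrite mulr_gt0.
have [K K0 KE] : exists2 K : R, 0 < K & K = 3 * 104 ^+ 2.
  by exists (3 * 104 ^+ 2) => //; rewrite mulr_gt0 // exprn_gt0.
pose C1 : R := speed R * K * 2.
have C10 : 0 < C1 by rewrite !mulr_gt0 //; lra.
have [D D0 DE] : exists2 D : R, 0 < D & D = 65 ^+ 2 + 65 by exists (65 ^+ 2 + 65) => //; lra.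
exists (ln 311 + C1 * (1 + D * (2 * A + 2))).
  have : 0 <= ln (311 : R) by rewrite ln_ge0 //; lra.
  have h : 0 < D * (2 * A + 2) by apply: mulr_gt0 => //; lra.
  have : 0 < C1 * (1 + D * (2 * A + 2)) by apply: mulr_gt0 => //; lra.
  by lra.
move=> L p M c p0 pn M0.
set V := expect _ _ _.
have V0 : 0 <= V by apply: (expect_ge0 (weight_ge0 p0 pn)) => s _; exact: sqr_ge0.
have AV0 : 0 <= A * V by rewrite mulr_ge0 // ltW.
have [lam [lam0 lamV lam_le]] := exists_scale AV0.
have lam1 : 1 <= lam%:R :> R by rewrite ler1n.
have p1 : p <= 1.
  have : p * 1 <= p * (period L)%:R by rewrite ler_pM2l // ler1n.
  by lra.
have [m pm_lo pm_hi] : exists2 m : nat, 64 * lam%:R <= p * m%:R & p * m%:R <= 65 * lam%:R.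
  have x0 : 0 <= 64 * lam%:R / p by rewrite divr_ge0 // ltW.
  have /andP[m1 m2] := truncn_itv x0.
  exists (Num.truncn (64 * lam%:R / p)).+1.
    by rewrite [X in _ <= X]mulrC -ler_pdivrMr // ltW.
  by rewrite -natr1 mulrDr mulr1; move: m1; rewrite ler_pdivlMr //; lra.
have m0 : (0 < m)%N by rewrite lt0n; apply: contraTneq pm_lo => ->; rewrite mulr0 -ltNge; lra.
(* the flat surface grows by at least 8 * lam, up to an exponentially small probability *)
have gr := growth p0 pn M m c (ell := 8 * lam%:R) rho lam0 ltac:(lra).
rewrite -/V in gr.
have small (x : R) : x <= - 8 -> expR x <= 1 / 9.
  move=> x8; apply: (@le_trans _ _ (expR (- 8))); first by rewrite ler_expR.
  have h : 1 + 8 <= expR (8 : R) := expR_ge1Dx 8.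
  have e0 := expR_gt0 (8 : R).
  by rewrite expRN -[_^-1]mul1r ler_pdivrMr //; lra.
have e1 : expR (speed R * p * m%:R - 2 * (rho * lam)%:R) <= 1 / 9.
  apply: small; rewrite natrM -mulrA.
  have h1 : speed R * (p * m%:R) <= speed R * (65 * lam%:R) by rewrite ler_pM2l //; lra.
  have h2 : (65 * speed R + 8) * lam%:R <= rho%:R * lam%:R by rewrite ler_pM2r //; lra.
  have : 0 <= rho%:R * lam%:R :> R by rewrite mulr_ge0.
  lra.
have e2 : expR (2 * (8 * lam%:R) - 3 / 8 * p * m%:R) <= 1 / 9.
  by apply: small; lra.
have e3 : (period rho)%:R * V / lam%:R ^+ 2 <= 1 / 4.
  rewrite ler_pdivrMr ?exprn_gt0 //; last by lra.
  by rewrite /A in lamV; lra.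
have gain : 5 / 2 * lam%:R <= mean L p (M + m) - mean L p M.
  apply: le_trans gr.
  have -> : 8 * lam%:R - 3 * lam%:R = 5 * lam%:R :> R by ring.
  have : 5 * lam%:R * (1 / 2) <= 5 * lam%:R * (1 - (period rho)%:R * V / lam%:R ^+ 2 -
     expR (speed R * p * m%:R - 2 * (rho * lam)%:R) -
     expR (2 * (8 * lam%:R) - 3 / 8 * p * m%:R)).
    by rewrite ler_wpM2l //; lra.
  lra.
have [j jm hj] : exists2 j, (j < m)%N & p / 26 <= mean L p (M + j).+1 - mean L p (M + j).
  apply: contrapT => no.
  have : mean L p (M + m) - mean L p M < m%:R * (p / 26).
    apply: telescope_lt => // j jm; rewrite ltNge; apply/negP => hj.
    by apply: no; exists j.
  lra.
have LR := linear_response p0 pn c hj; rewrite -KE in LR.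
(* heights at the two times differ by at most the number of rings at the origin in between *)
have V'_le : expect (@weight R L p) (M + j).+1 (fun s => (height R s - c) ^+ 2) <=
    2 * (V + D * lam%:R ^+ 2).
  rewrite -addnS expect_cat.
  apply: (@le_trans _ _ (expect (@weight R L p) M (fun s1 => expect (@weight R L p) j.+1 (fun s2 =>
     2 * ((height R s1 - c) ^+ 2 + (hitcount s2 0)%:R ^+ 2))))).
    apply: (le_expect (weight_ge0 p0 pn)) => s1' _; apply: (le_expect (weight_ge0 p0 pn)) => s2 _.
    rewrite /height run_cat.
    have := run_ge (run flat s1') s2 0; have := run_le (run flat s1') s2 0.
    rewrite -!(ler_int R) intrD -[(hitcount s2 0)%:~R]/((hitcount s2 0)%:R).
    set a := (run flat s1' 0)%:~R; set b := _%:~R; set d := _%:R => h1 h2.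
    have d2 : (b - a) ^+ 2 <= d ^+ 2 by rewrite lerXn2r ?nnegrE //; lra.
    have := sqr_ge0 (a - c - (b - a)); nra.
  rewrite (@eq_expect _ _ _ M _ (fun s1 => 2 * ((height R s1 - c) ^+ 2 +
     expect (@weight R L p) j.+1 (fun s2 => (hitcount s2 0)%:R ^+ 2)))); last first.
    by move=> s1' _; rewrite expectZ expectD (expect_cst (weight_sum L p)).
  rewrite expectZ expectD (expect_cst (weight_sum L p)) -/V ler_pM2l // lerD2l.
  apply: le_trans (expect_hitcount2 L p j.+1 0) _.
  have h1 : p * j.+1%:R <= p * m%:R by rewrite ler_pM2l // ler_nat.
  have h0 : 0 <= p * j.+1%:R by rewrite mulr_ge0 // ltW.
  set q := p * j.+1%:R in h0 h1 *.
  have h3 : q ^+ 2 <= (65 * lam%:R) ^+ 2 by rewrite lerXn2r ?nnegrE //; lra.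
  have h4 : lam%:R <= lam%:R ^+ 2 :> R by rewrite expr2 ler_peMl.
  have E65 : (65 * lam%:R) ^+ 2 = 65 ^+ 2 * lam%:R ^+ 2 :> R by exact: exprMn.
  by rewrite E65 in h3; rewrite DE; lra.
have H1 := log_sum_mono M j.+1 p0 (_ : 1 <= 311); rewrite addnS in H1.
have H2 := log_sum_ge M p0 (_ : 1 <= 311).
have r1 : 1 <= 311 :> R by lra.
have := le_trans (H2 r1) (le_trans (H1 r1) LR).
rewrite ler_pdivrMr ?speed_gt0 //.
have pM0 : 0 < p * M%:R by rewrite mulr_gt0 // ltr0n.
have lnr : ln (p * M%:R) <= ln (radius p 311 M).
  rewrite ler_ln ?posrE ?radius_gt0 // /radius.
  have : 1 * (p * M%:R) <= speed R * (p * M%:R) by rewrite ler_pM2r.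
  lra.
move=> main.
have l311 : 0 <= ln (311 : R) by rewrite ln_ge0.
set W := expect _ _ _ in V'_le main.
have WA : W <= 2 * (V + D * (2 * (A * V) + 2)).
  by apply: le_trans V'_le _; rewrite ler_pM2l // lerD2l ler_pM2l.
have main2 : ln (p * M%:R) <= ln 311 + C1 * (V + D * (2 * (A * V) + 2)).
  have h : K * W * speed R <= K * (2 * (V + D * (2 * (A * V) + 2))) * speed R.
    by rewrite ler_pM2r ?speed_gt0 // ler_pM2l.
  have -> : C1 * (V + D * (2 * (A * V) + 2)) =
     K * (2 * (V + D * (2 * (A * V) + 2))) * speed R by rewrite /C1; ring.
  by rewrite -lerBlDl; apply: le_trans h; apply: le_trans main; rewrite lerD2r.
apply: le_trans main2 _.
rewrite [X in _ <= X]mulrDl; apply: lerD.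
  by rewrite ler_peMr // lerDl.
rewrite -mulrA ler_pM2l //.
have hDA : 0 <= D * A by rewrite mulr_ge0 // ltW.
have hDV : 0 <= D * V by rewrite mulr_ge0 // ltW.
lra.
Qed.

End DiscreteVariance.

(** * Clock paths and height paths *)

Section Paths.
Variable R : realType.

Lemma near_rightP (t : R) (Q : R -> Prop) :
  (\forall s \near t^'+, Q s) -> exists2 e, 0 < e & forall s, t < s < t + e -> Q s.
Proof.
rewrite near_withinE => /nbhs_ballP[e /= e0 h]; exists e => // s /andP[ts se].
by apply: h => //=; rewrite /ball /= ltr_norml; lra.
Qed.

Lemma near_leftP (t : R) (Q : R -> Prop) :
  (\forall s \near t^'-, Q s) -> exists2 e, 0 < e & forall s, t - e < s < t -> Q s.
Proof.
rewrite near_withinE => /nbhs_ballP[e /= e0 h]; exists e => // s /andP[ts se].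
by apply: h => //=; rewrite /ball /= ltr_norml; lra.
Qed.

Lemma near_left_itv (a t : R) (Q : R -> Prop) : a < t ->
  (forall s, a < s < t -> Q s) -> \forall s \near t^'-, Q s.
Proof.
move=> at_ h; near=> s; apply: h; apply/andP; split; near: s.
  exact: nbhs_left_gt.
exact: nbhs_left_lt.
Unshelve. all: by end_near. Qed.

Lemma left_limit_unique A (g : R -> A) t u v :
  has_left_limit g t u -> has_left_limit g t v -> u = v.
Proof.
move=> /near_leftP[e e0 he] /near_leftP[e' e'0 he'].
have h : 0 < Num.min e e' by rewrite lt_min e0.
have h1 : Num.min e e' <= e by rewrite ge_min lexx.
have h2 : Num.min e e' <= e' by rewrite ge_min lexx orbT.
rewrite -(he (t - Num.min e e' / 2)) ?(he' (t - Num.min e e' / 2)) //; lra.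
Qed.

(** Real induction: the supremum of the times up to which the path is constant
cannot be smaller than [b]. *)
Lemma locally_constant A (g : R -> A) a b : a <= b ->
  (forall t, a <= t < b -> \forall s \near t^'+, g s = g t) ->
  (forall t, a < t <= b -> has_left_limit g t (g t)) -> g b = g a.
Proof.
move=> ab gr gl.
pose E := [set s | a <= s <= b /\ forall u, a <= u <= s -> g u = g a].
have Ea : E a by split => [|u]; [lra|move=> ua; congr g; lra].
have hE : has_sup E by split; [exists a | exists b => s [/andP[]]].
have ac : a <= sup E by apply: ub_le_sup => //; exact: hE.2.
have cb : sup E <= b by apply: ge_sup; [exists a|move=> s [/andP[]]].
(* strictly before the supremum the path is constant by definition *)
have below u : a <= u -> u < sup E -> g u = g a.
  move=> au uc; have [|e Ee ue] := @sup_adherent _ E (sup E - u) _ hE; first lra.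
  by apply: Ee.2; lra.
have gc : g (sup E) = g a.
  have [<-//|ac'] := eqVneq a (sup E).
  have ac2 : a < sup E by rewrite lt_neqAle ac' ac.
  have [|e e0 he] := near_leftP (gl (sup E) _); first lra.
  pose s := Num.max a (sup E - e / 2).
  have s1 : a <= s by rewrite le_max lexx.
  have s2 : sup E - e / 2 <= s by rewrite le_max lexx orbT.
  have s3 : s < sup E by rewrite gt_max; lra.
  by rewrite -(he s) ?below //; lra.
have [<-//|cb'] := eqVneq (sup E) b.
have cb2 : sup E < b by rewrite lt_neqAle cb' cb.
have [|e e0 he] := near_rightP (gr (sup E) _); first lra.
pose s := Num.min b (sup E + e / 2).
have s1 : s <= b by rewrite ge_min lexx.
have s2 : s <= sup E + e / 2 by rewrite ge_min lexx orbT.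
have s3 : sup E < s by rewrite lt_min; lra.
have Es : E s.
  split=> [|u /andP[au us]]; first lra.
  have [uc|cu|->//] := ltgtP u (sup E); first exact: below.
  by rewrite he //; lra.
have : s <= sup E by apply: ub_le_sup => //; exact: hE.2.
by rewrite leNgt s3.
Qed.

Variable n : R -> nat.
Hypothesis n_path : counting_path n.

Lemma no_ring a b : 0 <= a -> n b = n a -> forall t, a < t <= b -> ~ rings n t.
Proof.
case: n_path => _ mono _ a0 nab t /andP[at_ tb] rg; apply: rg.
apply: (near_left_itv at_) => s /andP[as_ st].
have := mono a s a0 (ltW as_); have := mono s t (ltW (le_lt_trans a0 as_)) (ltW st).
have := mono t b (ltW (le_lt_trans a0 at_)) tb; lia.
Qed.

(** The ringing time is the infimum of the times at which the count has
increased; right continuity makes it a minimum. *)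
Lemma one_ring a b : 0 <= a -> a <= b -> n b = (n a).+1 ->
  exists t, [/\ a < t <= b, rings n t, forall s, a <= s < t -> n s = n a &
    n t = n b].
Proof.
case: n_path => _ mono rc a0 ab nab.
pose E := [set s | a <= s <= b /\ n s = (n a).+1].
have Eb : E b by split => //; lra.
have hE : has_inf E by split; [exists b | exists a => s [/andP[]]].
have ct : inf E <= b by apply: ge_inf => //; exact: hE.2.
have ac : a <= inf E by apply: lb_le_inf; [exists b|move=> s [/andP[]]].
have Ec : n (inf E) = (n a).+1.
  have [|e e0 he] := near_rightP (rc (inf E) _); first exact: le_trans ac.
  have [s [/andP[as_ sb] ns] se] := inf_adherent e0 hE.
  have : inf E <= s by apply: ge_inf; [exact: hE.2|split => //; lra].
  rewrite le_eqVlt => /orP[/eqP ->//|cs].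
  by rewrite -ns he //; lra.
have ac2 : a < inf E.
  rewrite lt_neqAle ac andbT; apply/eqP => E1.
  by move: Ec; rewrite -E1; lia.
have below s : a <= s < inf E -> n s = n a.
  move=> /andP[as_ sc].
  have sb : s <= b by lra.
  have h1 := mono a s a0 as_; have h2 := mono s b (le_trans a0 as_) sb.
  have [ns|ns] := eqVneq (n s) (n a).+1; last by lia.
  have : inf E <= s by apply: ge_inf; [exact: hE.2|split => //; rewrite as_].
  by rewrite leNgt sc.
exists (inf E); split => //.
- by rewrite ac2.
- move=> ll; have : has_left_limit n (inf E) (n a).
    by apply: (near_left_itv ac2) => s h; apply: below; lra.
  by move=> /(left_limit_unique ll); rewrite Ec; lia.
- by rewrite Ec nab.
Qed.

End Paths.

Section DynamicsPaths.
Variables (R : realType) (n : int -> R -> nat) (f : R -> int -> int).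
Hypothesis n_path : forall x, counting_path (n x).
Hypothesis f_dyn : rsos_dynamics n f.

Lemma height_const x a b : 0 <= a -> a <= b ->
  (forall t, a < t <= b -> ~ rings (n x) t) -> f b x = f a x.
Proof.
move=> a0 ab noring; case: f_dyn => fr fl.
apply: (locally_constant (g := fun t => f t x) ab).
  by move=> t /andP[at_ _]; apply: fr; exact: le_trans at_.
move=> t tab; have t0 : 0 < t by case/andP: tab => h _; exact: le_lt_trans h.
have [h [hl hr]] := fl t t0.
by have [_ ->] := hr x; [exact: hl | exact: noring].
Qed.

Lemma height_left_limit x a t : 0 <= a -> a < t ->
  (forall u, a < u < t -> ~ rings (n x) u) -> has_left_limit (fun s => f s x) t (f a x).
Proof.
move=> a0 at_ noring; apply: (near_left_itv at_) => s /andP[as_ st].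
apply: height_const => //; first exact: ltW.
by move=> u /andP[au us]; apply: noring; rewrite au (le_lt_trans us).
Qed.

Lemma height_slot_quiet x a b : 0 <= a -> a <= b -> n x b = n x a -> f b x = f a x.
Proof. by move=> a0 ab nx; apply: height_const => //; exact: no_ring. Qed.

(** When [x] is the only ringing site among its neighbours, the profile seen at the
ringing time is still the one of the beginning of the interval at [x] and at
both neighbours. *)
Lemma height_slot_ring x a b : 0 <= a -> a <= b -> n x b = (n x a).+1 ->
  n (x + 1) b = n (x + 1) a -> n (x - 1) b = n (x - 1) a ->
  f b x = rsos_update (f a) x.
Proof.
move=> a0 ab nx nr nl.
have [t [/andP[at_ tb] rt before nt]] := one_ring (n_path x) a0 ab nx.
have t0 : 0 < t by exact: le_lt_trans at_.
have [_ fl] := f_dyn; have [h [hl hr]] := fl t t0.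
have -> : f b x = f t x.
  by apply: height_slot_quiet => //; exact: ltW.
have [-> // _] := hr x.
have h0 : h x = f a x.
  apply: left_limit_unique (hl x) _; apply: height_left_limit => // u /andP[au ut].
  by apply: (no_ring (n_path x) a0 (b := u)); [apply: before; rewrite ut ltW|rewrite au lexx].
have hn y : n y b = n y a -> h y = f a y.
  move=> ny; apply: left_limit_unique (hl y) _; apply: height_left_limit => // u /andP[au ut].
  by apply: (no_ring (n_path y) a0 ny); rewrite au (le_trans (ltW ut)).
by rewrite /rsos_update h0 !hn.
Qed.

Variable L : nat.

(** Each slot has exactly the prescribed content in the window [-L, L]: one ring at
the prescribed site, if any, and no ring elsewhere in the window. *)
Definition matches (t : nat -> R) (s : seq (slot L)) : Prop :=
  forall (i : nat) (x : 'I_(period L)), (i < size s)%N ->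
    (n (x%:Z - L%:Z) (t i.+1) - n (x%:Z - L%:Z) (t i))%N = (nth None s i == Some x).

(** The boundary of the window and everything outside: there the heights of the
process and of the periodic chain are not compared. *)
Definition far (z : int) : bool := (L <= `|z|)%N.

(** Induction on the number of slots. At an uncontaminated ringing site the
neighbours lie in the window, and they do not ring since the slot contains a
single ring. *)
Lemma matches_run (t : nat -> R) (s : seq (slot L)) : 0 <= t 0 ->
  (forall i, t i <= t i.+1) -> f (t 0) =1 flat -> matches t s ->
  forall y, ~~ runB far s y -> ~~ far y /\ f (t (size s)) y = run flat s y.
Proof.
move=> t0 tmono f0.
have ti i : 0 <= t i by elim: i => // i IH; exact: le_trans (tmono i).
have incr x i : (n x (t i) <= n x (t i.+1))%N by have [_ + _] := n_path x; apply.
elim/last_ind: s => [|s o IH] m y; first by move=> h; split => //; exact: f0.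
have ms : matches t s.
  move=> i x is_; have := m i x; rewrite size_rcons nth_rcons is_; apply; exact: ltnW.
have mo (x : 'I_(period L)) :
    (n (x%:Z - L%:Z) (t (size s).+1) - n (x%:Z - L%:Z) (t (size s)))%N = (o == Some x).
  by have := m (size s) x; rewrite size_rcons nth_rcons ltnn eqxx; apply.
(* sites of the window are exactly the centred representatives *)
have site (z : int) : (`|z| <= L)%N -> exists x : 'I_(period L), z = x%:Z - L%:Z.
  move=> zL; have xp : (`|(z + L%:Z)%R| < period L)%N by rewrite /period; lia.
  by exists (Ordinal xp) => /=; lia.
have hits_site (x : 'I_(period L)) (z : int) : (`|z| <= L)%N -> z = x%:Z - L%:Z ->
    forall o', hits o' z = (o' == Some x).
  move=> zL -> [x'|] //=; rewrite subrK modz_small; last by rewrite ltz_nat ltn_ord.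
  by rewrite eqz_nat eq_sym.
have quiet (z : int) : (`|z| <= L)%N -> ~~ hits o z -> n z (t (size s).+1) = n z (t (size s)).
  move=> zL nh; have [x zx] := site z zL; have := mo x; rewrite -zx.
  rewrite (hits_site x z zL zx) in nh; rewrite (negbTE nh); have := incr z (size s); lia.
rewrite runB_rcons run_rcons size_rcons /stepB negb_or => /andP[By nb].
have [yfar fy] := IH ms y By; split => //.
have yL : (`|y| < L)%N by move: yfar; rewrite /far -ltnNge.
rewrite /step; case hy: (hits o y) nb => /= nb; last first.
  by rewrite (height_slot_quiet (ti (size s)) (tmono _)) //; apply: quiet; [exact: ltnW | rewrite hy].
move: nb; rewrite negb_or => /andP[B1 B2].
have [far1 f1] := IH ms _ B1; have [far2 f2] := IH ms _ B2.
have single (z : int) : (`|z| <= L)%N -> z != y -> ~~ hits o z.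
  move=> zL zy; have [x zx] := site z zL; have [x' yx'] := site y (ltnW yL).
  rewrite (hits_site x z zL zx); apply: contra zy => /eqP oE.
  by move: hy; rewrite (hits_site x' y (ltnW yL) yx') oE => /eqP[xx']; rewrite zx yx' xx'.
have L1 : (`|(y + 1)%R| <= L)%N by lia.
have L2 : (`|(y - 1)%R| <= L)%N by lia.
rewrite (height_slot_ring (ti (size s)) (tmono _)) //.
- by rewrite !rsos_updateE /local_min fy f1 f2.
- have [x yx] := site y (ltnW yL); have := mo x; rewrite -yx.
  by move: hy; rewrite (hits_site x y (ltnW yL) yx) => ->; have := incr y (size s); lia.
- by apply: quiet => //; apply: single => //; lia.
- by apply: quiet => //; apply: single => //; lia.
Qed.

End DynamicsPaths.

(** * Law of the contents of the slots *)

Lemma independent_uniq_seq (R : realType) (d : measure_display)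
    (T : measurableType d) (P : probability T R) (I : choiceType)
    (G : I -> set_system T) (r : seq I) (E : I -> set T) :
  mutually_independent P G -> uniq r -> (forall i, i \in r -> G i (E i)) ->
  P (\bigcap_(i in [set` r]) E i) = (\prod_(i <- r) P (E i))%E.
Proof.
move=> indep ur GE.
pose J := [fset i in r]%fset.
have memJ i : (i \in J) = (i \in r) by rewrite inE.
have -> : [set` r] = [set` J] by apply/seteqP; split => i /=; rewrite memJ.
rewrite indep; last by move=> i; rewrite memJ; exact: GE.
by apply: perm_big; apply: uniq_perm => //; exact: fset_uniq.
Qed.

Lemma measurable_subn_eq (d : measure_display) (T : measurableType d) (X Y : T -> nat) k :
  (forall A : set nat, measurable (X @^-1` A)) ->
  (forall A : set nat, measurable (Y @^-1` A)) ->
  measurable [set w | (X w - Y w)%N = k].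
Proof.
move=> mX mY.
have -> : [set w | (X w - Y w)%N = k] =
    \bigcup_b (Y @^-1` [set b] `&` X @^-1` [set a | (a - b)%N = k]).
  apply/seteqP; split => [w /= E|w [b _] [/= -> E]] //.
  by exists (Y w).
by apply: bigcupT_measurable => b; exact: measurableI.
Qed.

Section SlotEvents.
Variables (R : realType) (d : measure_display) (T : measurableType d).
Variables (P : probability T R) (N : int -> R -> {RV P >-> nat}).
Hypothesis clocks : independent_poisson_clocks N.
Variables (L : nat) (delta : R).
Hypothesis delta_gt0 : 0 < delta.

Definition grid (i : nat) : R := i%:R * delta.

Lemma grid_ge0 i : 0 <= grid i.
Proof. by rewrite mulr_ge0 // ltW. Qed.

Lemma grid_lt i : grid i < grid i.+1.
Proof. by rewrite ltr_pM2r // ltr_nat. Qed.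

Definition cell (x : int) (i k : nat) : set T :=
  [set w | (N x (grid i.+1) w - N x (grid i) w)%N = k].

Definition target (s : seq (slot L)) (x : int) (i : nat) : nat :=
  if nth None s i is Some z then (z%:Z - L%:Z == x) : nat else 0%N.

(** The clocks at different sites are independent and so are the increments of one
clock; the prescribed contents of the slots are therefore arranged site by
site. *)
Definition site_event (s : seq (slot L)) (x : int) : set T :=
  \bigcap_(i in [set` iota 0 (size s)]) cell x i (target s x i).

Definition slot_event (s : seq (slot L)) : set T :=
  [set w | matches (fun x r => N x r w) grid s].

Definition sites : seq int := [seq (z : 'I_(period L))%:Z - L%:Z | z <- enum 'I_(period L)].

Lemma sites_uniq : uniq sites.
Proof.
rewrite map_inj_uniq ?enum_uniq // => x y /= /(congr1 (fun z => z + L%:Z)).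
by rewrite !subrK => -[/val_inj].
Qed.

Lemma slot_eventE s : slot_event s = \bigcap_(x in [set` sites]) site_event s x.
Proof.
apply/seteqP; split => w /=.
  move=> m _ /mapP[z _ ->] i /=; rewrite mem_iota add0n => /andP[_ is_].
  rewrite /cell /= m // /target; case: (nth None s i) => [z'|] //=.
  by rewrite (inj_eq (addIr _)) eqz_nat.
move=> m i z is_.
have := m (z%:Z - L%:Z) (map_f _ (mem_enum _ z)) i; rewrite /= mem_iota add0n => /(_ is_).
rewrite /cell /= => ->; rewrite /target; case: (nth None s i) => [z'|] //=.
by rewrite (inj_eq (addIr _)) eqz_nat.
Qed.

Lemma measurable_cell x i k : measurable (cell x i k).
Proof.
by apply: measurable_subn_eq => A; rewrite -[X in measurable X]setTI; apply: measurable_funP.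
Qed.

Lemma measurable_slot_event s : measurable (slot_event s).
Proof.
rewrite slot_eventE; apply: fin_bigcap_measurable; first exact: finite_seq.
move=> x _; apply: fin_bigcap_measurable; first exact: finite_seq.
by move=> i _; exact: measurable_cell.
Qed.

Lemma site_event_in_sigma s x : sigma_of_process (N x) (site_event s x).
Proof.
rewrite /sigma_of_process; set GG := \bigcup_(_ in _) _.
have mN r : 0 <= r -> forall A : set nat,
    measurable ((N x r : g_sigma_algebraType GG -> nat) @^-1` A).
  move=> r0 A; apply: sub_sigma_algebra; exists r => //; exists A => //.
  by rewrite setTI.
suff : measurable (site_event s x : set (g_sigma_algebraType GG)) by [].
apply: fin_bigcap_measurable; first exact: finite_seq.
move=> i _.
by apply: (@measurable_subn_eq _ (g_sigma_algebraType GG)); apply: mN; exact: grid_ge0.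
Qed.

Lemma probability_cell x i k : P (cell x i k) = (poisson_pmf delta k)%:E.
Proof.
have [_ _ h] := clocks.1 x.
rewrite h ?grid_ge0 ?grid_lt // mul1r; congr (poisson_pmf _ _)%:E.
by rewrite /grid -natr1; ring.
Qed.

Lemma probability_site_event s x : P (site_event s x) =
  (\prod_(i < size s) poisson_pmf delta (target s x i))%:E.
Proof.
have [_ h _] := clocks.1 x.
have indep := h grid (grid_ge0 0) (fun i => ltW (grid_lt i)).
rewrite (independent_uniq_seq (E := fun i => cell x i (target s x i)) indep) ?iota_uniq //.
  rewrite -(big_mkord xpredT (fun i => poisson_pmf delta (target s x i))) /index_iota subn0.
  by rewrite -prodEFin; apply: eq_bigr => i _; exact: probability_cell.
move=> i _; exists [set target s x i] => //.
by rewrite setTI.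
Qed.

(** Probability of a ring at a given site of the window, given that the window has
at most one ring during a slot. *)
Definition ring_prob : R := delta / (1 + (period L)%:R * delta).

(** Probability that the window has at most one ring during a slot. *)
Definition good_prob : R :=
  (1 + (period L)%:R * delta) * expR (- ((period L)%:R * delta)).

Lemma slot_prob (o : slot L) :
  \prod_(z < period L)
    poisson_pmf delta (if o is Some z' then ((z' : nat) == z)%N : nat else 0%N) =
  good_prob * weight ring_prob o.
Proof.
set n := period L.
have pm0 : poisson_pmf delta 0 = expR (- delta).
  by rewrite /poisson_pmf delta_gt0 expr0 fact0 invr1 !mul1r.
have pm1 : poisson_pmf delta 1 = delta * expR (- delta).
  by rewrite /poisson_pmf delta_gt0 expr1 invr1 mulr1.
have en : expR (- delta) ^+ n = expR (- (n%:R * delta)) by rewrite -expRM_natl mulrN.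
have D0 : 1 + n%:R * delta != 0 by rewrite gt_eqF // ltr_wpDr // mulr_ge0 // ltW.
case: o => [z0|].
  rewrite (bigD1 z0) //= eqxx pm1.
  rewrite (eq_bigr (fun=> expR (- delta))); last first.
    move=> z zz0; have -> : ((z0 : nat) == z) = false by rewrite eq_sym; exact: negbTE zz0.
    exact: pm0.
  rewrite prodr_const cardC1 card_ord /good_prob /ring_prob -/n -en.
  rewrite -[n in RHS]prednK ?period_gt0 // [in RHS]exprS prednK ?period_gt0 //.
  by field.
rewrite prodr_const card_ord pm0 en /good_prob /weight /ring_prob -/n.
by field.
Qed.

Lemma probability_slot_event s : P (slot_event s) =
  (good_prob ^+ size s * \prod_(o <- s) weight ring_prob o)%:E.
Proof.
rewrite slot_eventE (independent_uniq_seq clocks.2) ?sites_uniq //; last first.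
  by move=> x _; exact: site_event_in_sigma.
rewrite (eq_bigr (fun x => (\prod_(i < size s) poisson_pmf delta (target s x i))%:E)); last first.
  by move=> x _; exact: probability_site_event.
rewrite prodEFin; congr (_%:E).
rewrite big_map big_enum /= exchange_big /=.
rewrite (big_nth None) big_mkord -[in good_prob ^+ _](card_ord (size s)) -prodr_const -big_split /=.
apply: eq_bigr => i _; rewrite -slot_prob; apply: eq_bigr => z _; congr (poisson_pmf _ _).
rewrite /target; case: (nth None s i) => // z'.
by rewrite (inj_eq (addIr _)) eqz_nat.
Qed.

End SlotEvents.

(** * From the continuous variance to the discrete one *)

(** Enumeration of the contents of [k] slots, which turns [expect] into a finite sum
([expect_all_seqs]). *)
Fixpoint all_seqs (O : finType) (k : nat) : seq (seq O) :=
  if k is k'.+1 then [seq o :: s | o <- enum O, s <- all_seqs O k'] else [:: [::]].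

Lemma all_seqs_size (O : finType) k s : s \in all_seqs O k -> size s = k.
Proof.
elim: k s => [|k IH] s /=; first by rewrite inE => /eqP ->.
by move=> /allpairsP[] [a s'] /= [] _ /IH <- ->.
Qed.

Lemma all_seqs_uniq (O : finType) k : uniq (all_seqs O k).
Proof.
elim: k => [|k IH] //=; apply: allpairs_uniq => //; first exact: enum_uniq.
by move=> [a s] [a' s'] _ _ /= [-> ->].
Qed.

Lemma expect_all_seqs (R : realType) (O : finType) (w : O -> R) k G :
  expect w k G = \sum_(s <- all_seqs O k) (\prod_(o <- s) w o) * G s.
Proof.
elim: k G => [|k IH] G /=; first by rewrite big_seq1 big_nil mul1r.
rewrite big_allpairs_dep big_enum /expect1 /=; apply: eq_bigr => o _.
by rewrite IH mulr_sumr; apply: eq_bigr => s _; rewrite big_cons mulrA.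
Qed.

Lemma bernoulli_ineq (R : realDomainType) (x : R) k : 0 <= x -> x <= 1 ->
  1 - k%:R * x <= (1 - x) ^+ k.
Proof.
move=> x0 x1; elim: k => [|k IH]; first by rewrite mul0r subr0 expr0.
rewrite exprS -natr1; apply: (@le_trans _ _ ((1 - x) * (1 - k%:R * x))).
  have : 0 <= k%:R * x ^+ 2 by rewrite mulr_ge0 // sqr_ge0.
  lra.
by rewrite ler_wpM2l //; lra.
Qed.

Section Transfer.
Variables (R : realType) (d : measure_display) (T : measurableType d).
Variables (P : probability T R) (N : int -> R -> {RV P >-> nat}).
Variable f : R -> int -> {RV P >-> int}.
Hypothesis clocks : independent_poisson_clocks N.
Hypothesis f_dyn : rsos_from_zero N f.

Lemma ae_counting_path : \forall w \ae P, forall x, counting_path (fun r => N x r w).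
Proof.
have h (b : bool) : \forall w \ae P, forall i : nat,
    counting_path (fun r => N (if b then i%:Z else - i%:Z) r w).
  by apply: ae_foralln => i; have [] := clocks.1 (if b then i%:Z else - i%:Z).
apply: filterS2 (h true) (h false) => w h1 h2 x.
have [x0|x0] := leP 0 x; first by have := h1 `|x|%N; rewrite gez0_abs.
by have := h2 `|x|%N; rewrite ltz0_abs // opprK.
Qed.

Definition sq_deviation (t m : R) (w : T) : R := ((f t 0 w)%:~R - m) ^+ 2.

Lemma measurable_sq_deviation (t m : R) : measurable_fun [set: T] (sq_deviation t m).
Proof.
rewrite (_ : sq_deviation t m = (fun z : int => (z%:~R - m) ^+ 2) \o f t 0) //.
by apply: measurableT_comp => //; exact: measurable_funP.
Qed.

(** The slot events are disjoint, on each of them the squared deviation is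
almost surely that of the chain unless the origin is contaminated, and their
probabilities are those of the chain up to the factor [good_prob ^+ M]. *)
Lemma integral_height_ge (L M : nat) (delta m : R) : 0 < delta ->
  ((good_prob L delta ^+ M *
    expect (@weight R L (ring_prob L delta)) M
      (fun s => (~~ runB (far L) s 0)%:R * (height R s - m) ^+ 2))%:E <=
   \int[P]_w (sq_deviation (grid delta M) m w)%:E)%E.
Proof.
move=> d0.
set c := fun s : seq (slot L) => (~~ runB (far L) s 0)%:R * (height R s - m) ^+ 2.
have c0 s : 0 <= c s by rewrite mulr_ge0 // sqr_ge0.
pose S := all_seqs (slot L : finType) M.
pose A (s : seq (slot L)) := slot_event N delta s.
have mA s : measurable (A s) by exact: measurable_slot_event.
have -> : (good_prob L delta ^+ M * expect (@weight R L (ring_prob L delta)) M c)%:E =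
    (\int[P]_w (\sum_(s <- S) (c s * \1_(A s) w)%:E))%E.
  rewrite ge0_integral_sum //; last 2 first.
  - by move=> s; apply/measurable_EFinP; apply: measurable_funM => //; exact: measurable_indic.
  - by move=> s w _; rewrite lee_fin mulr_ge0 // indicE.
  rewrite expect_all_seqs mulr_sumr -sumEFin big_seq [RHS]big_seq; apply: eq_bigr => s sS.
  under eq_integral do rewrite EFinM.
  rewrite ge0_integralZl_EFin //; last first.
    by apply/measurable_EFinP; exact: measurable_indic.
  rewrite integral_indic // setIT.
  transitivity ((c s)%:E *
    (good_prob L delta ^+ M * \prod_(o <- s) weight (ring_prob L delta) o)%:E)%E.
    by rewrite -EFinM; congr (_%:E); ring.
  congr (_ * _)%E; rewrite -[in LHS](all_seqs_size sS).
  exact/esym/(probability_slot_event clocks d0).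
apply: ae_ge0_le_integral => //.
- by move=> w _; apply: sume_ge0 => s _; rewrite lee_fin mulr_ge0 // indicE.
- apply: emeasurable_sum => s; apply/measurable_EFinP; apply: measurable_funM => //.
- by move=> w _; rewrite lee_fin sqr_ge0.
- by apply/measurable_EFinP; exact: measurable_sq_deviation.
apply: filterS2 ae_counting_path f_dyn => w paths [dyn f0] _.
rewrite sumEFin lee_fin.
have [ [s [sS As] ]|none] := pselect (exists s, s \in S /\ A s w); last first.
  rewrite big_seq big1 ?sqr_ge0 // => s sS; rewrite indicE memNset ?mulr0 //.
  by move=> As; apply: none; exists s.
rewrite (bigD1_seq s) //=; last exact: all_seqs_uniq.
rewrite big_seq_cond big1 ?addr0; last first.
  move=> s' /andP[s'S s's]; rewrite indicE memNset ?mulr0 // => As'.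
  move/eqP: s's; apply; apply: (@eq_from_nth _ None).
    by rewrite (all_seqs_size s'S) (all_seqs_size sS).
  move=> i is'; have is_ : (i < size s)%N.
    by rewrite (all_seqs_size sS) -(all_seqs_size s'S).
  (* the content of a slot is determined by the counts of the clocks *)
  have key (x : 'I_(period L)) : (nth None s' i == Some x) = (nth None s i == Some x).
    have := As i x is_; rewrite (As' i x is').
    by do 2 case: eqP.
  case E : (nth None s' i) => [x|].
    by have := key x; rewrite E eqxx => /esym/eqP ->.
  case E' : (nth None s i) => [x|] //.
  by have := key x; rewrite E E' eqxx.
rewrite indicE mem_set // mulr1 /c.
case: (boolP (runB _ s 0)) => [_|nB]; first by rewrite mul0r sqr_ge0.
rewrite mul1r.
have g0 : grid delta 0 = 0 by rewrite /grid mul0r.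
have [|||_] := @matches_run _ _ _ paths dyn L (grid delta) s _ _ _ As 0 nB.
- by rewrite g0.
- by move=> i; exact/ltW/grid_lt.
- by move=> y; rewrite g0 f0.
by rewrite (all_seqs_size sS) /height /sq_deviation => ->.
Qed.

End Transfer.

Section Contamination.
Variables (R : realType) (L : nat) (p : R).
Hypothesis p_gt0 : 0 < p.
Hypothesis pn_le : p * (period L)%:R <= 1 / 2.
Local Notation Ex := (expect (@weight R L p)).

(** By Cauchy-Schwarz the contaminated configurations contribute at most the square
root of a fourth moment, bounded uniformly in [M], times the probability of
contamination, which is exponentially small in [L]. *)
Lemma expect_far_le (M : nat) (t m : R) : p * M%:R <= t ->
  8 * (24 * expR (expR 1 * t) + m ^+ 4) * expR (speed R * t) <= L%:R ->
  Ex M (fun s => (height R s - m) ^+ 2) - 1 <=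
  Ex M (fun s => (~~ runB (far L) s 0)%:R * (height R s - m) ^+ 2).
Proof.
move=> pMt L_ge; set Q := 8 * _ in L_ge.
have wge := @weight_ge0 R L p p_gt0 pn_le.
have sp := speed_gt0 R.
pose b (s : seq (slot L)) : R := (runB (far L) s 0)%:R.
have Eb : Ex M b <= expR (speed R * t - 2 * L%:R).
  apply: le_trans (@expect_runB _ _ _ p_gt0 pn_le M (far L) (expR (- (2 * L%:R))) 0 _ _) _.
  - exact: expR_ge0.
  - move=> z; case hz: (far L z); last by rewrite mulr_ge0 ?expR_ge0.
    rewrite -expRD; apply: le_trans (expR_ge1Dx _).
    have : L%:R <= `|z|%N%:R :> R by rewrite ler_nat.
    by rewrite mulr1n; lra.
  - rewrite mulr0 expR0 mulr1 -expRD ler_expR.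
    have : speed R * (p * M%:R) <= speed R * t by rewrite ler_pM2l.
    lra.
have E4 : Ex M (fun s => ((height R s - m) ^+ 2) ^+ 2) <= Q.
  apply: (@le_trans _ _ (Ex M (fun s => 8 * (24 * expR (hitcount s 0)%:R + m ^+ 4)))).
    apply: (le_expect wge) => s _.
    have h0 : 0 <= height R s by rewrite ler0z; exact: (run_ge flat s 0).
    have hc : height R s <= (hitcount s 0)%:R.
      by have := run_le flat s 0; rewrite /flat add0r -(ler_int R).
    have h4 : (height R s) ^+ 4 <= 24 * expR (hitcount s 0)%:R.
      have := expR_ge1Dxn 3 h0; rewrite (_ : 4`!%:R = 24 :> R) // => e4.
      have : expR (height R s) <= expR (hitcount s 0)%:R by rewrite ler_expR.
      have : height R s ^+ 4 / 24 * 24 = height R s ^+ 4 by rewrite divfK.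
      lra.
    set h := height R s in h4 *.
    have : (h - m) ^+ 2 ^+ 2 <= 8 * (h ^+ 4 + m ^+ 4).
      have s1 := sqr_ge0 (h + m); have s2 := sqr_ge0 (h ^+ 2 - m ^+ 2).
      have a1 : (h - m) ^+ 2 <= 2 * (h ^+ 2 + m ^+ 2) by lra.
      have a2 : ((h - m) ^+ 2) ^+ 2 <= (2 * (h ^+ 2 + m ^+ 2)) ^+ 2.
        by rewrite lerXn2r ?nnegrE ?sqr_ge0 // mulr_ge0 // addr_ge0 ?sqr_ge0.
      have e4 (x : R) : x ^+ 4 = (x ^+ 2) ^+ 2 by rewrite -exprM.
      by rewrite !e4; lra.
    lra.
  rewrite expectZ expectD expectZ (expect_cst (weight_sum L p)) ler_pM2l // lerD2r ler_pM2l //.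
  apply: le_trans (expect_expR_hitcount p_gt0 pn_le M 0) _; rewrite ler_expR -mulrA.
  by rewrite ler_pM2l // expR_gt0.
have m4 : 0 <= m ^+ 4 by exact: exprn_even_ge0.
have Q0 : 0 <= Q by rewrite /Q mulr_ge0 // addr_ge0 // mulr_ge0 // expR_ge0.
have small : (Ex M (fun s => b s * (height R s - m) ^+ 2)) ^+ 2 <= 1.
  apply: le_trans (expect_CauchySchwarz wge M b (fun s => (height R s - m) ^+ 2)) _.
  rewrite (@eq_expect _ _ _ M (fun s => b s ^+ 2) b); last first.
    by move=> s _; rewrite /b; case: (runB _ _ _); rewrite ?expr1n ?expr0n.
  apply: (@le_trans _ _ (expR (speed R * t - 2 * L%:R) * Q)).
    apply: ler_pM => //; apply: (expect_ge0 wge) => s _; first by rewrite /b.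
    exact: sqr_ge0.
  rewrite expRD mulrAC mulrC expRN ler_pdivrMl ?expR_gt0 // mulr1 mulrC.
  apply: le_trans L_ge _; apply: le_trans (expR_ge1Dx _).
  have : 0 <= L%:R :> R by [].
  lra.
have small1 : Ex M (fun s => b s * (height R s - m) ^+ 2) <= 1.
  by rewrite leNgt; apply/negP => h; move: small; rewrite leNgt exprn_egt1.
have -> : Ex M (fun s => (~~ runB (far L) s 0)%:R * (height R s - m) ^+ 2) =
  Ex M (fun s => (height R s - m) ^+ 2) - Ex M (fun s => b s * (height R s - m) ^+ 2).
  rewrite -expectB; apply: eq_expect => s _; rewrite /b.
  by case: (runB _ _ _); rewrite ?mul0r ?mul1r ?subrr ?subr0.
lra.
Qed.

End Contamination.

Section VarianceBound.
Variables (R : realType) (d : measure_display) (T : measurableType d).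
Variables (P : probability T R) (N : int -> R -> {RV P >-> nat}).
Variable f : R -> int -> {RV P >-> int}.
Hypothesis clocks : independent_poisson_clocks N.
Hypothesis f_dyn : rsos_from_zero N f.

(** [good_prob] is [1] up to an error quadratic in the length of a slot, which is
negligible after summation over the slots. *)
Lemma good_prob_ge (L : nat) (delta : R) M : 0 < delta -> (period L)%:R * delta <= 1 ->
  1 - M%:R * ((period L)%:R * delta) ^+ 2 <= good_prob L delta ^+ M.
Proof.
move=> d0; set y := _ * delta => y1.
have y0 : 0 <= y by rewrite mulr_ge0 // ltW.
have y2 : y ^+ 2 <= 1 by rewrite expr_le1.
apply: le_trans (bernoulli_ineq _ (sqr_ge0 y) y2) _.
rewrite lerXn2r ?nnegrE //.
- by rewrite subr_ge0.
- by rewrite /good_prob -/y mulr_ge0 ?expR_ge0 // addr_ge0.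
have -> : 1 - y ^+ 2 = (1 + y) * (1 - y) by ring.
by rewrite /good_prob -/y ler_wpM2l ?addr_ge0 //; exact: expR_ge1Dx.
Qed.

(** First [L] is chosen large, to make contamination from the boundary negligible
up to time [t], then the number [M] of slots, to have at most one ring of the window
in each slot with probability at least [1 / 2]. *)
Lemma integral_sq_deviation_ge (C t m : R) : 0 < t ->
  (forall (L : nat) (p : R) (M : nat) (c : R),
    0 < p -> p * (period L)%:R <= 1 / 2 -> (0 < M)%N ->
    ln (p * M%:R) <= C * (1 + expect (@weight R L p) M (fun s => (height R s - c) ^+ 2))) ->
  0 < C ->
  (((ln (t / 2) / C - 2) / 2)%:E <= \int[P]_w (sq_deviation f t m w)%:E)%E.
Proof.
move=> t0 hC C0.
set rhs := (\int[P]_w _)%E.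
have rhs0 : (0 <= rhs)%E by apply: integral_ge0 => w _; rewrite lee_fin sqr_ge0.
have [neg|pos] := leP (ln (t / 2) / C - 2) 0.
  by apply: le_trans rhs0; rewrite lee_fin; lra.
have [L L_ge] : exists L : nat,
    8 * (24 * expR (expR 1 * t) + m ^+ 4) * expR (speed R * t) <= L%:R.
  have m4 : 0 <= m ^+ 4 by exact: exprn_even_ge0.
  set q := _ * _; have q0 : 0 <= q.
    by rewrite /q !mulr_ge0 ?expR_ge0 // addr_ge0 // mulr_ge0 // expR_ge0.
  by exists (Num.bound q); rewrite ltW // archi_boundP.
set n := period L.
have n0 : 0 < n%:R :> R by rewrite ltr0n.
have nt0 : 0 < n%:R * t by rewrite mulr_gt0.
have [M M_gt] : exists M : nat, n%:R * t + 2 * (n%:R * t) ^+ 2 < M%:R.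
  have q0 : 0 <= n%:R * t + 2 * (n%:R * t) ^+ 2.
    by rewrite addr_ge0 ?(ltW nt0) // mulr_ge0 // sqr_ge0.
  by exists (Num.bound (n%:R * t + 2 * (n%:R * t) ^+ 2)); rewrite archi_boundP.
have sq0 := sqr_ge0 (n%:R * t).
have M0R : 0 < M%:R :> R by lra.
have M0 : (0 < M)%N by rewrite -(ltr0n R).
pose delta := t / M%:R.
have d0 : 0 < delta by rewrite divr_gt0.
have Md : M%:R * delta = t by rewrite /delta mulrC divfK ?gt_eqF.
have nd1 : n%:R * delta <= 1 by rewrite /delta mulrA ler_pdivrMr // mul1r; lra.
have nd0 : 0 < n%:R * delta by rewrite mulr_gt0.
have gp : 1 / 2 <= good_prob L delta ^+ M.
  apply: le_trans (good_prob_ge M d0 nd1).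
  have -> : M%:R * (n%:R * delta) ^+ 2 = (n%:R * t) ^+ 2 / M%:R.
    by rewrite /delta; field; rewrite gt_eqF.
  have : (n%:R * t) ^+ 2 / M%:R <= 1 / 2 by rewrite ler_pdivrMr //; lra.
  lra.
pose p := ring_prob L delta.
have D0 : 0 < 1 + n%:R * delta by lra.
have p0 : 0 < p by rewrite /p /ring_prob divr_gt0.
have pn : p * n%:R <= 1 / 2.
  by rewrite /p /ring_prob mulrAC -/n ler_pdivrMr //; lra.
have pM : p * M%:R = t / (1 + n%:R * delta).
  by rewrite /p /ring_prob mulrAC [delta * _]mulrC Md.
have pM_le : p * M%:R <= t.
  by rewrite pM ler_pdivrMr // ler_peMr ?(ltW t0) //; lra.
have pM_ge : t / 2 <= p * M%:R.
  rewrite pM ler_pM2l // lef_pV2 ?posrE //; lra.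
have main := integral_height_ge clocks f_dyn L M m d0.
rewrite /grid Md -/rhs -/p in main.
apply: le_trans main; rewrite lee_fin.
have far_le := expect_far_le p0 pn pM_le L_ge.
have ln_le : ln (t / 2) <= C * (1 + expect (@weight R L p) M (fun s => (height R s - m) ^+ 2)).
  apply: le_trans (hC L p M m p0 pn M0).
  have t2 : 0 < t / 2 by rewrite divr_gt0.
  have pM0 : 0 < p * M%:R by rewrite mulr_gt0.
  by rewrite ler_ln.
set V := expect _ _ _ in ln_le far_le.
set W := expect _ _ _ in far_le *.
have VC : ln (t / 2) / C - 1 <= V.
  have : ln (t / 2) / C <= 1 + V by rewrite ler_pdivrMr // [X in _ <= X]mulrC.
  lra.
apply: (@le_trans _ _ (1 / 2 * W)); first by lra.
by rewrite ler_wpM2r //; lra.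
Qed.

End VarianceBound.

Unset Implicit Arguments.

Local Open Scope ereal_scope.

(** The centring constant in the variance is arbitrary in
[integral_sq_deviation_ge], so it may be the expectation of the height even
before the latter is known to be finite. *)
Theorem theorem8p1 (R : realType) (d : measure_display) (T : measurableType d)
    (P : probability T R) (N : int -> R -> {RV P >-> nat})
    (f : R -> int -> {RV P >-> int}) :
  independent_poisson_clocks N ->
  rsos_from_zero N f ->
  0 < limf_einf
        (fun t : R => 'V_P[fun w => ((f t 0%R w)%:~R : R)%R] / (ln t)%:E)
        (pinfty_nbhs R).
Proof.
move=> clocks f_dyn.
have [C C0 hC] := discrete_variance R.
pose t0 : R := expR (2 * ln 2 + 4 * C + 1)%R.
have key (t : R) : (t0 < t)%R ->
    ((1 / (4 * C))%R%:E <= 'V_P[fun w => ((f t 0%R w)%:~R : R)%R] / (ln t)%:E).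
  move=> tt0.
  have tp : (0 < t)%R by apply: lt_trans tt0; exact: expR_gt0.
  have lt : (2 * ln 2 + 4 * C + 1 < ln t)%R.
    by rewrite -(expRK (2 * ln 2 + 4 * C + 1)%R) ltr_ln ?posrE ?expR_gt0.
  have l2 : (0 <= ln 2 :> R)%R by rewrite ln_ge0 // ler1n.
  have lp : (0 < ln t)%R by lra.
  rewrite inver gt_eqF // lee_pdivlMr // -EFinM.
  rewrite /variance unlock unlock.
  set m := fine _.
  have := integral_sq_deviation_ge clocks f_dyn m tp hC C0.
  move=> h; apply: (@le_trans _ _ ((ln (t / 2) / C - 2) / 2)%R%:E).
    have -> : (ln (t / 2) = ln t - ln 2)%R by rewrite ln_div ?posrE.
    rewrite lee_fin -subr_ge0.
    have -> : (((ln t - ln 2) / C - 2) / 2 - 1 / (4 * C) * ln t =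
        (ln t - 2 * ln 2 - 4 * C) / (4 * C))%R by field; rewrite gt_eqF.
    by rewrite divr_ge0 //; lra.
  apply: le_trans h _; rewrite le_eqVlt; apply/orP; left; apply/eqP.
  by apply: eq_integral => w _; rewrite /sq_deviation /= expr2.
apply: (@lt_le_trans _ _ (1 / (4 * C))%R%:E); first by rewrite lte_fin divr_gt0 // mulr_gt0.
rewrite limf_einfE; apply: le_ereal_sup_tmp.
exists (ereal_inf ((fun t : R => 'V_P[fun w => ((f t 0%R w)%:~R : R)%R] / (ln t)%:E)
    @` [set t | (t0 < t)%R])).
  by exists [set t | (t0 < t)%R] => //; exists t0; split => //; exact: num_real.
by apply: le_ereal_inf_tmp => _ [t /= tt0 <-]; exact: key.
Qed.
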